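(* Let $n\ge 2$ and let $C=\{x\in\mathbb{R}^n: x_1\ge x_2\ge\cdots\ge x_n,\ x_{n-1}\ge -x_n\}$ be the Weyl chamber of $D_n$. Let $\eta$ be an interior point of $C$, $t>0$, and let $N_t(x)=(2\pi t)^{-1/2}e^{-x^2/(2t)}$. For $\lambda$ in the interior of $C$: (1) the density at $\lambda$, at time $t$, of standard $n$-dimensional Brownian motion started at $\eta$ and killed when it first hits the boundary of $C$ is $$b_t(\eta,\lambda)=\tfrac12\Bigl(\det\bigl[N_t(\lambda_i-\eta_j)-N_t(\lambda_i+\eta_j)\bigr]_{i,j=1}^n+\det\bigl[N_t(\lambda_i-\eta_j)+N_t(\lambda_i+\eta_j)\bigr]_{i,j=1}^n\Bigr);$$ (2) the density at $\lambda$, at time $t$, of standard $n$-dimensional Brownian motion started at $\eta$ and reflected at the boundary of $C$ is $$b'_t(\eta,\lambda)=\tfrac12\Bigl(\operatorname{per}\bigl[N_t(\lambda_i-\eta_j)-N_t(\lambda_i+\eta_j)\bigr]_{i,j=1}^n+\operatorname{per}\bigl[N_t(\lambda_i-\eta_j)+N_t(\lambda_i+\eta_j)\bigr]_{i,j=1}^n\Bigr).$$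
   Context: $\operatorname{per}$ denotes the permanent of a matrix. The killed density $b_t(\eta,\cdot)$ is the density of the sub-probability measure $A\mapsto P(X(t)\in A,\ X(s)\in\operatorname{int}C\text{ for all }s\le t)$ for standard Brownian motion $X$ with $X(0)=\eta$. Reflected Brownian motion in $C$ is the process obtained from $X$ by replacing $X(t)$ at each time by the unique point of $C$ in its orbit under the group $D_n$ of coordinate permutations combined with an even number of sign changes. *)

(* Defs.v *)
From HB Require Import structures.
From mathcomp Require Import all_boot all_order all_algebra all_fingroup.
From mathcomp Require Import all_classical all_reals all_analysis.
Set Implicit Arguments.
Unset Strict Implicit.
Unset Printing Implicit Defensive.
Import Order.TTheory GRing.Theory Num.Theory.
Import numFieldNormedType.Exports.
Local Open Scope classical_set_scope.
Local Open Scope ring_scope.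

(* Row vectors carry the product sigma-algebra, exactly as tuples do in the
   library. On 'rV[R]_n with R : realType it is the Borel sigma-algebra. *)
Section measurable_rV.
Context {d} {T : sigmaRingType d} (n : nat).

Let coord : 'I_n -> 'rV[T]_n -> T := fun i x => x 0 i.

Let rV_set0 : g_sigma_preimage coord set0.
Proof. exact: sigma_algebra0. Qed.

Let rV_setC A : g_sigma_preimage coord A -> g_sigma_preimage coord (~` A).
Proof. exact: sigma_algebraC. Qed.

Let rV_bigcup (F : _^nat) : (forall i, g_sigma_preimage coord (F i)) ->
  g_sigma_preimage coord (\bigcup_i (F i)).
Proof. exact: sigma_algebra_bigcup. Qed.

HB.instance Definition _ := @isMeasurable.Build (measure_tuple_display d)
  'rV[T]_n (g_sigma_preimage coord) rV_set0 rV_setC rV_bigcup.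

End measurable_rV.

Lemma measurable_rV_coord d (T : sigmaRingType d) n (i : 'I_n) :
  measurable_fun [set: 'rV[T]_n] (fun x => x 0 i).
Proof.
move=> _ Y mY; rewrite setTI; apply: sub_sigma_algebra => /=.
rewrite -bigcup_seq/=; exists i => /=; first by rewrite mem_index_enum.
by exists Y => //; rewrite setTI.
Qed.

Lemma measurable_fun_rVP d1 d2 (T1 : measurableType d1) (T2 : measurableType d2)
    n (f : T1 -> 'rV[T2]_n) :
  measurable_fun [set: T1] f <->
  forall i, measurable_fun [set: T1] (fun x => f x 0 i).
Proof.
split=> [mf i|mf].
  exact: (measurableT_comp (@measurable_rV_coord _ T2 n i) mf).
suff /(_ _ _)/= sub : g_sigma_preimage (fun (i : 'I_n) (x : T1) => f x 0 i)
    `<=` measurable.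
  have := @g_sigma_preimage_comp _ T2 n _ (fun i (x : 'rV[T2]_n) => x 0 i) _ f.
  move=> E _ A mA; apply: sub; move: E => /= ->; exists A => //.
apply: smallest_sub; first exact: sigma_algebra_measurable.
rewrite -bigcup_seq/=; apply: bigcup_sub => i _ A [B mB <-].
exact: mf.
Qed.

(* Lebesgue measure on R^n, as the n-fold product of the one on R *)
Section lebesgue_rV.
Context {R : realType}.

Definition cons_rV n (p : measurableTypeR R * 'rV[R]_n) : 'rV[R]_n.+1 :=
  row_mx (p.1 : R)%:M p.2.


Definition uncons_rV n (x : 'rV[R]_n.+1) : measurableTypeR R * 'rV[R]_n :=
  (x 0 ord0, \row_i x 0 (lift ord0 i)).

Lemma cons_rV_ord0 n p : @cons_rV n p 0 ord0 = p.1.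
Proof.
by rewrite /cons_rV mxE; case: splitP => // j; rewrite ord1 mxE.
Qed.

Lemma cons_rV_lift n p i : @cons_rV n p 0 (lift ord0 i) = p.2 0 i.
Proof.
rewrite /cons_rV mxE; case: splitP => [j|k /= /succn_inj /val_inj ->//].
by rewrite ord1.
Qed.

Lemma cons_rVK n : cancel (@cons_rV n) (@uncons_rV n).
Proof.
move=> p; rewrite /uncons_rV cons_rV_ord0 [RHS]surjective_pairing; congr pair.
by apply/rowP => i; rewrite mxE cons_rV_lift.
Qed.

Lemma measurable_cons_rV n : measurable_fun setT (@cons_rV n).
Proof.
apply/measurable_fun_rVP => i; case: (unliftP ord0 i) => [j|] ->.
- rewrite (_ : (fun _ => _) = (fun x : 'rV[R]_n => x 0 j) \o snd).
    exact: (measurableT_comp (measurable_rV_coord j) measurable_snd).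
  by apply/funext => p; rewrite cons_rV_lift.
- rewrite (_ : (fun _ => _) = fst); first exact: measurable_fst.
  by apply/funext => p; rewrite cons_rV_ord0.
Qed.

Lemma measurable_uncons_rV n : measurable_fun setT (@uncons_rV n).
Proof.
apply/measurable_fun_pairP; split => /=.
  exact: (measurable_rV_coord (ord0 : 'I_n.+1)).
apply/measurable_fun_rVP => i /=.
rewrite (_ : (fun _ => _) = fun x : 'rV[R]_n.+1 => x 0 (lift ord0 i)).
  exact: measurable_rV_coord.
by apply/funext => x; rewrite mxE.
Qed.

Section step.
Variables (n : nat) (mu : {sigma_finite_measure set 'rV[R]_n -> \bar R}).

Definition lebesgue_rV_step : set 'rV[R]_n.+1 -> \bar R :=
  pushforward (lebesgue_measure \x mu)%E (@cons_rV n).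

HB.instance Definition _ := Measure.copy lebesgue_rV_step
  (measure_function_pushforward__canonical__measure_function_Measure
     (lebesgue_measure \x mu)%E (@measurable_cons_rV n)).

Let sigma_finite_step : sigma_finite setT lebesgue_rV_step.
Proof.
have /sigma_finiteP[F [FT ndF Foo]] := sigma_finiteT (@lebesgue_measure R).
have /sigma_finiteP[G [GT ndG Goo]] := sigma_finiteT mu.
exists (fun k => @uncons_rV n @^-1` (F k `*` G k)).
  rewrite -preimage_bigcup (_ : \bigcup_k _ = setT) ?preimage_setT//.
  rewrite -subTset => -[x y] _.
  have [i _ Fx] : (\bigcup_k F k) x by rewrite -FT.
  have [j _ Gy] : (\bigcup_k G k) y by rewrite -GT.
  exists (maxn i j) => //; split => /=.
  - by move: x Fx; exact/subsetPset/ndF/leq_maxl.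
  - by move: y Gy; exact/subsetPset/ndG/leq_maxr.
move=> k; have [mF Fk] := Foo k; have [mG Gk] := Goo k; split.
  rewrite -[X in measurable X]setTI.
  by apply: measurable_uncons_rV => //; exact: measurableX.
rewrite /lebesgue_rV_step /pushforward -comp_preimage.
rewrite (_ : _ \o _ = id) ?preimage_id; last exact/funext/cons_rVK.
by rewrite product_measure1E// lte_mul_pinfty// ge0_fin_numE.
Qed.

HB.instance Definition _ :=
  @Measure_isSigmaFinite.Build _ _ _ lebesgue_rV_step sigma_finite_step.

End step.

Fixpoint lebesgue_rV n : {sigma_finite_measure set 'rV[R]_n -> \bar R} :=
  if n is m.+1 then lebesgue_rV_step (lebesgue_rV m) else \d_(0 : 'rV[R]_0).

End lebesgue_rV.

Lemma lebesgue_rV_box (R : realType) n (A : 'I_n -> set R) :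
  (forall i, measurable (A i)) ->
  lebesgue_rV n [set x | forall i, A i (x 0 i)] =
  (\prod_(i < n) lebesgue_measure (A i))%E.
Proof.
elim: n A => [|n IH] A mA.
  by rewrite big_ord0 /= diracE mem_set// => -[].
pose B := [set x : 'rV[R]_n | forall i, A (lift ord0 i) (x 0 i)].
have mB : measurable B.
  rewrite (_ : B = \bigcap_(i in [set: 'I_n])
      ((fun x : 'rV[R]_n => x 0 i) @^-1` A (lift ord0 i))); last first.
    by apply/seteqP; split=> x Bx i; [move=> _|]; exact: Bx.
  apply: fin_bigcap_measurable => // i _.
  by rewrite -[X in measurable X]setTI; exact: measurable_rV_coord.
have mA0 : measurable (A ord0) by [].
rewrite big_ord_recl -IH => [|i]; last exact: mA.
rewrite -(product_measure1E (@lebesgue_measure R) (lebesgue_rV n) mA0 mB).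
rewrite /lebesgue_rV_step /pushforward /=; congr (product_measure1 _ _ _).
apply/seteqP; split=> -[x y] /=.
  move=> Axy; split=> [|i]; first by have := Axy ord0; rewrite cons_rV_ord0.
  by have := Axy (lift ord0 i); rewrite cons_rV_lift.
move=> [Ax Ay] i; case: (unliftP ord0 i) => [j|] ->.
  by rewrite cons_rV_lift; exact: Ay.
by rewrite cons_rV_ord0.
Qed.

Definition permanent (R : comPzRingType) n (A : 'M[R]_n) : R :=
  \sum_(s : 'S_n) \prod_i A i (s i).

Section weyl_chamber_D.
Context {R : realType} {n : nat}.
Implicit Types x y : 'rV[R]_n.

(* With 0-based indices, the last condition reads
   - x_(n-1) <= x_(n-2); it is meant for n >= 2. *)
Definition chamberD : set 'rV[R]_n := [set x |
  (forall i j : 'I_n, j = i.+1 :> nat -> x 0 j <= x 0 i) /\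
  (forall i j : 'I_n, i.+2 = n -> j.+1 = n -> - x 0 j <= x 0 i)].

Definition orbitD x : set 'rV[R]_n := [set y |
  exists (s : 'S_n) (E : {set 'I_n}),
    ~~ odd #|E| /\ y = \row_i ((-1) ^+ (i \in E) * x 0 (s i))].

(* The point of the chamber in the orbit of x; it exists and is unique, so the
   default value 0 is never used. *)
Definition foldD x : 'rV[R]_n := xget 0 (chamberD `&` orbitD x).

End weyl_chamber_D.

Section brownian_motion.
Context {R : realType} {d} {Omega : measurableType d} (P : probability Omega R).

(* Since A i may be the whole space, the product rule over all of I contains
   the product rules over its subfamilies. *)
Definition mutually_independent d' (E : measurableType d') (I : finType)
    (Y : I -> Omega -> E) : Prop :=
  forall A : I -> set E, (forall i, measurable (A i)) ->
    P [set w | forall i, A i (Y i w)] = (\prod_i P [set w | A i (Y i w)])%E.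

Record brownian_motion n (eta : 'rV[R]_n) (X : R -> Omega -> 'rV[R]_n) : Prop :=
  BrownianMotion {
    bm_measurable : forall t, 0 <= t -> measurable_fun setT (X t) ;
    bm_start : forall w, X 0 w = eta ;
    bm_continuous : forall w, {within `[0, +oo[, continuous (X ^~ w)} ;
    bm_independent_increments : forall (m : nat) (s : nat -> R), 0 <= s 0 ->
      (forall k, (k < m)%N -> s k <= s k.+1) ->
      mutually_independent (fun (k : 'I_m) w => X (s k.+1) w - X (s k) w) ;
    bm_independent_coordinates : forall s t, 0 <= s -> s < t ->
      mutually_independent (fun (i : 'I_n) w => (X t w - X s w) 0 i) ;
    bm_gaussian_coordinates : forall s t, 0 <= s -> s < t ->
      forall (i : 'I_n) (A : set R), measurable A ->
      P [set w | A ((X t w - X s w) 0 i)] = normal_prob 0 (Num.sqrt (t - s)) A }.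

Definition killed_law n (U : set 'rV[R]_n) (X : R -> Omega -> 'rV[R]_n) (t : R)
    (A : set 'rV[R]_n) : \bar R :=
  P [set w | A (X t w) /\ forall s, 0 <= s <= t -> U (X s w)].

Definition law n (Y : R -> Omega -> 'rV[R]_n) (t : R) (A : set 'rV[R]_n) :
  \bar R := P [set w | A (Y t w)].

End brownian_motion.

(* m has no mass outside U and density f on U with respect to Lebesgue measure.
   A density is only defined almost everywhere; when U is open, continuity on U
   determines its value at each point of U. *)
Definition density_on (R : realType) n (U : set 'rV[R]_n)
    (m : set 'rV[R]_n -> \bar R) (f : 'rV[R]_n -> R) : Prop :=
  [/\ measurable_fun U f,
      forall x, U x -> {for x, continuous f},
      forall x, U x -> 0 <= f x &
      forall A, measurable A ->
        m A = (\int[lebesgue_rV n]_(x in A `&` U) (f x)%:E)%E].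

Section kernels.
Context {R : realType}.

Definition heat_kernel (t x : R) : R :=
  (Num.sqrt (2 * pi * t))^-1 * expR (- x ^+ 2 / (2 * t)).

Definition kernel_minus n (t : R) (eta lambda : 'rV[R]_n) : 'M[R]_n :=
  \matrix_(i, j) (heat_kernel t (lambda 0 i - eta 0 j)
                  - heat_kernel t (lambda 0 i + eta 0 j)).

Definition kernel_plus n (t : R) (eta lambda : 'rV[R]_n) : 'M[R]_n :=
  \matrix_(i, j) (heat_kernel t (lambda 0 i - eta 0 j)
                  + heat_kernel t (lambda 0 i + eta 0 j)).

End kernels.

(* Main.v *)
From HB Require Import structures.
Require Import Defs.
From mathcomp Require Import all_boot all_order all_algebra all_fingroup.
From mathcomp Require Import all_classical all_reals all_analysis.
From mathcomp Require Import measurable_realfun.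
From mathcomp Require Import ring lra zify.
Set Implicit Arguments.
Unset Strict Implicit.
Unset Printing Implicit Defensive.
Import Order.TTheory GRing.Theory Num.Theory.
Import numFieldNormedType.Exports.
Local Open Scope classical_set_scope.
Local Open Scope ring_scope.

(** Let g = (s, E) range over the pairs of a permutation and an even set of sign
    changes, acting on R^n by [sact]; the determinant of g is the sign of s.
    Expand the determinants and permanents over permutations, and each product
    over the set of indices carrying the sign change.  Half the sum of the two
    terms keeps the even sets only, so that the two formulas read
        sum_g sgn(s) p_t(g eta, lambda)   and   sum_g p_t(g eta, lambda),
    where p_t is the Gaussian density ([half_sum_expansion]).  Since
    p_t(g eta, .) is the density of g X(t) ([marginal_law]), what has to be shown
    are two identities between laws, U being the interior of the chamber:
        P(X(t) in A, X stays in U on [0, t]) = sum_g sgn(s) P(g X(t) in A and U),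
        P(fold X(t) in A)                    = sum_g P(g X(t) in A and U).

    The second one ([fold_law]) holds because the orbit of a point that lies on no
    wall meets U exactly once, and X(t) almost surely lies on no wall.

    The first one ([killed_alternating]) is the reflection principle.  Let F be a
    bounded Lipschitz function with F (r x) = - F x for each reflection r of the
    group.  Then
        E[F(X(t))] = E[F(X(t)); X stays in U on [0, t]]      ([killed_mean]).
    To see this, watch the path on a finite time grid and consider the event that
    a wall is the first one to be approached to within delta, and that this happens
    at the grid time s.  Up to time s this event depends on the past only, and
    X(t) = X(s) + W where W is independent of the past and has the same law as r W,
    r being the reflection in that wall.  As F(X(s) + r W) = - F(r X(s) + W), the
    contribution of the event is half the mean of F(X(s) + W) - F(r X(s) + W), hence
    bounded by the Lipschitz constant times the value of the root at X(s)
    ([reflection_bound]).  That value is at most delta plus the oscillation of the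
    path over one grid step.  The events are disjoint, so the total error is at most
    the mean of one function of the path ([discrete_killing]), which tends to a
    multiple of delta when the grid is refined, and then to 0 with delta.

    The identity for measures follows by taking for F the antisymmetrization of a
    Lipschitz approximation of the indicator of A and U; this is possible for A in a
    pi-system of open sets, and the two sides are signed combinations of finite
    measures, which agree everywhere once they agree on a pi-system
    ([signed_measure_unique]).  That the alternating sum is nonnegative on U comes
    last: its integrals over small boxes are probabilities, and it is continuous
    ([continuous_density_ge0]). *)


(** * Signed permutations and the chamber *)

Section signed_permutations.
Context {R : realType} {n : nat}.
Implicit Types (x y : 'rV[R]_n) (g h : 'S_n * {set 'I_n}).

(** The coordinates are permuted first, the signs changed afterwards, as in the
    definition of the orbit. *)
Definition sact g x : 'rV[R]_n := \row_i ((-1) ^+ (i \in g.2) * x 0 (g.1 i)).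

(** The product for which [sact] is an action. *)
Definition compD g h : 'S_n * {set 'I_n} :=
  ((g.1 * h.1)%g, [set i | (i \in g.2) (+) (g.1 i \in h.2)]%SET).

Lemma sactE g x i : sact g x 0 i = (-1) ^+ (i \in g.2) * x 0 (g.1 i).
Proof. by rewrite mxE. Qed.

Lemma norm_sact g x i : `|sact g x 0 i| = `|x 0 (g.1 i)|.
Proof. by rewrite sactE normrM normrX normrN1 expr1n mul1r. Qed.

Lemma sact1 x : sact (1%g, finset.set0) x = x.
Proof. by apply/rowP => i; rewrite sactE /= finset.in_set0 perm1 mul1r. Qed.

Lemma sact_comp g h x : sact g (sact h x) = sact (compD g h) x.
Proof.
by apply/rowP => i; rewrite !sactE /= mulrA -signr_addb finset.inE permM.
Qed.

(** Parity as an exclusive or over all indices, so that it can be split and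
    reindexed like a sum. *)
Lemma odd_cards (E : {set 'I_n}) : odd #|E| = \big[addb/false]_i (i \in E).
Proof.
rewrite -sum1_card big_mkcond /= (big_morph odd oddD (erefl : odd 0 = false)).
by apply: eq_bigr => i _; case: (i \in E).
Qed.

Lemma odd_compD g h : odd #|(compD g h).2| = odd #|g.2| (+) odd #|h.2|.
Proof.
rewrite !odd_cards (reindex_inj (@perm_inj _ g.1) : \big[_/_]_i (i \in h.2) = _).
by rewrite -big_split; apply: eq_bigr => i _; rewrite finset.inE.
Qed.

Lemma orbitDP x y :
  orbitD x y <-> exists g, ~~ odd #|g.2| /\ y = sact g x.
Proof.
split=> [[s [E [oE ->]]]|[[s E] /= [oE ->]]]; first by exists (s, E).
by exists s, E.
Qed.

Lemma prod_sact g x : \prod_i sact g x 0 i = (-1) ^+ odd #|g.2| * \prod_i x 0 i.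
Proof.
under eq_bigr do rewrite sactE.
rewrite big_split /= (reindex_inj (@perm_inj _ g.1) : \prod_i x 0 i = _).
congr (_ * _); rewrite odd_cards.
by rewrite (big_morph (fun b : bool => (-1) ^+ b : R) (@signr_addb R) (erefl _)).
Qed.

End signed_permutations.

Section chamber.
Context {R : realType} {n : nat}.
Hypothesis n2 : (2 <= n)%N.
Implicit Types (x y : 'rV[R]_n) (g h : 'S_n * {set 'I_n}).

(** The coordinates decrease, and x_(n-1) + x_n >= 0 bounds the last one below;
    together: each coordinate dominates the absolute value of all later ones.
    In this form the last index plays no special part. *)
Lemma chamberDP x : chamberD x <->
  forall a b : 'I_n, (a < b)%N -> `|x 0 b| <= x 0 a.
Proof.
split=> [[mono last]|H]; last first.
  split=> i j ij; first by rewrite (le_trans (ler_norm _))// H// ij.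
  move=> jn; apply: (@le_trans _ _ `|x 0 j|); last by apply: H; lia.
  by rewrite -normrN ler_norm.
have le k : forall i j : 'I_n, (j = i + k :> nat)%N -> x 0 j <= x 0 i.
  elim: k => [|k IH] i j ijk.
    by rewrite (_ : j = i)//; apply: val_inj; rewrite /= ijk addn0.
  have kn : (i + k < n)%N by have := ltn_ord j; lia.
  rewrite (le_trans (mono (Ordinal kn) j _)) ?IH//= ijk; lia.
move=> a b ab.
have n1 : (n.-1 < n)%N by lia.
have n2' : (n.-2 < n)%N by lia.
rewrite ler_norml; apply/andP; split; last first.
  by apply: (le (b - a)%N); lia.
rewrite lerNl (@le_trans _ _ (x 0 (Ordinal n2')))//; last first.
  by apply: (le (n.-2 - a)%N) => /=; have := ltn_ord b; lia.
rewrite (@le_trans _ _ (- x 0 (Ordinal n1)))//; last by apply: last => /=; lia.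
rewrite lerN2; apply: (le (n.-1 - b)%N) => /=; have := ltn_ord b; lia.
Qed.

Lemma near_strict x a b : `|x 0 b| < x 0 a ->
  nbhs x [set z : 'rV[R]_n | `|z 0 b| < z 0 a].
Proof.
move=> xab.
have cf : {for x, continuous (fun z : 'rV[R]_n => z 0 a - `|z 0 b|)}.
  apply: (@continuousB R R^o 'rV[R]_n (fun z => z 0 a) (fun z => `|z 0 b|)).
    exact: coord_continuous.
  apply: continuous_comp; first exact: coord_continuous.
  exact: norm_continuous.
have ab0 : 0 < x 0 a - `|x 0 b| by rewrite subr_gt0.
have := @cvgr_gt _ _ (nbhs x) (nbhs_filter x) _ _ cf _ ab0.
by apply: filterS => z; rewrite subr_gt0.
Qed.

(** If a ball around x is contained in the chamber, lowering the coordinate a by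
    half the radius still satisfies the weak inequality, so x satisfies the strict
    one.  Conversely the strict inequalities are finitely many open conditions. *)
Lemma interior_chamberD : (@chamberD R n)° =
  [set x | forall a b : 'I_n, (a < b)%N -> `|x 0 b| < x 0 a].
Proof.
apply/seteqP; split => x /=.
  move=> /nbhs_ballP[e /= e0 xeC] a b ab.
  pose y : 'rV[R]_n := \row_i (x 0 i - (i == a)%:R * (e / 2)).
  have /chamberDP/(_ a b ab) : chamberD y.
    apply: xeC; split => // i j; rewrite ord1 /ball /= mxE opprB addrCA subrr addr0.
    case: eqP => _; rewrite ?(mul0r, mul1r, normr0)// ger0_norm; lra.
  have /negbTE ba : b != a by rewrite -val_eqE /= gtn_eqF.
  by rewrite !mxE eqxx ba mul0r subr0 mul1r; lra.
move=> Hx; rewrite /interior.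
pose Q (ab : 'I_n * 'I_n) (z : 'rV[R]_n) := (ab.1 < ab.2)%N ->
  `|z 0 ab.2| < z 0 ab.1.
have H : forall ab, nbhs x (Q ab).
  move=> [a b]; have [ab|ba] := ltnP a b.
    by apply: filterS (near_strict (Hx _ _ ab)) => z Hz _.
  apply: filterS (@filterT _ (nbhs x) (nbhs_filter x)) => z _.
  by rewrite /Q /= ltnNge ba.
apply: filterS (@filter_forall _ _ Q (nbhs x) (nbhs_filter x) H) => z Hz.
by apply/(chamberDP z) => a b ab; exact/ltW/(Hz (a, b)).
Qed.

End chamber.

Section chamber_orbit.
Context {R : realType} {n : nat}.
Hypothesis n2 : (2 <= n)%N.
Implicit Types (x y : 'rV[R]_n) (g h : 'S_n * {set 'I_n}).

Let abs_seq y : seq R := [seq `|y 0 i| | i <- enum 'I_n].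

Let abs_seq_sact g x : perm_eq (abs_seq (sact g x)) (abs_seq x).
Proof.
rewrite (_ : abs_seq (sact g x) = [seq `|x 0 i| | i <- map g.1 (enum 'I_n)]).
  apply: perm_map; apply: uniq_perm; rewrite ?enum_uniq//.
    by rewrite map_inj_uniq ?enum_uniq//; exact: perm_inj.
  move=> i; rewrite mem_enum; apply/mapP; exists ((g.1^-1)%g i).
    by rewrite mem_enum.
  by rewrite permKV.
by rewrite -map_comp; apply: eq_map => i /=; rewrite norm_sact.
Qed.

Let abs_seq_sorted y : chamberD y -> sorted >=%R (abs_seq y).
Proof.
move=> /(chamberDP n2) Cy.
have : sorted (fun i j : 'I_n => (i <= j)%N) (enum 'I_n).
  have := iota_sorted 0 n.
  by rewrite -val_enum_ord sorted_map.
apply: homo_sorted => i j ij.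
case: (ltngtP i j) ij => // [ij _|/val_inj -> _] /=; last exact: lexx.
exact: (le_trans (Cy _ _ ij) (ler_norm _)).
Qed.

(** Both points list the same absolute values in decreasing order, and all their
    coordinates except the last are nonnegative, so they can only differ in the sign
    of the last one.  The product of all coordinates, which an even number of sign
    changes preserves, excludes this. *)
Lemma chamberD_unique g h x : ~~ odd #|g.2| -> ~~ odd #|h.2| ->
  chamberD (sact g x) -> chamberD (sact h x) -> sact g x = sact h x.
Proof.
move=> og oh Cg Ch; set y := sact g x; set z := sact h x.
have Eabs i : `|y 0 i| = `|z 0 i|.
  have Es : abs_seq y = abs_seq z.
    apply: (sorted_eq (leT := >=%R)); rewrite ?abs_seq_sorted//.
    - exact: ge_trans.
    - exact: ge_anti.
    - by rewrite (perm_trans (abs_seq_sact g x))// perm_sym abs_seq_sact.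
  by move/eq_in_map : Es => /(_ i); apply; rewrite mem_enum.
have /(chamberDP n2) Cy := Cg; have /(chamberDP n2) Cz := Ch.
have n1 : (n.-1 < n)%N by lia.
pose l := Ordinal n1.
have lt_last (i : 'I_n) : i != l -> (i < l)%N.
  by rewrite -val_eqE /=; have := ltn_ord i; lia.
have Eyz i : i != l -> y 0 i = z 0 i.
  move=> /lt_last il.
  rewrite -(ger0_norm (le_trans (normr_ge0 _) (Cy _ _ il))).
  by rewrite -(ger0_norm (le_trans (normr_ge0 _) (Cz _ _ il))).
have Eprod : \prod_i y 0 i = \prod_i z 0 i.
  by rewrite /y /z !prod_sact (negbTE og) (negbTE oh).
apply/rowP => i; have [->|] := eqVneq i l; last exact: Eyz.
move: Eprod; rewrite (bigD1 l)// (bigD1 (F := z 0) l)//=.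
rewrite (eq_bigr (z 0)) => [|j jl]; last exact: Eyz.
have [/eqP|P0] := eqVneq (\prod_(j | j != l) z 0 j) 0; last exact: mulIf.
rewrite prodf_seq_eq0 => /hasP[j _ /andP[/lt_last jl /eqP zj0]] _.
have zl0 : `|z 0 l| = 0 by apply/le_anti; rewrite normr_ge0 -zj0 Cz.
have yl0 := zl0; rewrite -Eabs in yl0.
by rewrite (normr0_eq0 zl0) (normr0_eq0 yl0).
Qed.

(** In the interior the absolute values decrease strictly, which determines the
    permutation.  Only the last coordinate may vanish, so the sign changes are
    determined at all other indices, and at the last one by parity. *)
Lemma chamberD_free g h x : ~~ odd #|g.2| -> ~~ odd #|h.2| ->
  (chamberD°) (sact g x) -> chamberD (sact h x) -> g = h.
Proof.
move=> og oh Ug Ch.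
have E := chamberD_unique og oh (interior_subset Ug) Ch.
move: Ug; rewrite interior_chamberD// => Ug.
set y := sact g x in E Ug.
have inj_abs i j : `|y 0 i| = `|y 0 j| -> i = j.
  move=> Eij; apply: val_inj; case: (ltngtP i j) => // /Ug.
  - by rewrite -Eij ltNge ler_norm.
  - by rewrite Eij ltNge ler_norm.
have E1 : g.1 = h.1.
  apply/permP => i; pose k := (g.1^-1)%g (h.1 i).
  have : `|y 0 k| = `|y 0 i|.
    by rewrite {2}E !norm_sact /k permKV.
  by move=> /inj_abs ki; rewrite -[in LHS]ki permKV.
have n1 : (n.-1 < n)%N by lia.
pose l := Ordinal n1.
have E2 i : i != l -> (i \in g.2) = (i \in h.2).
  rewrite -val_eqE /= => il.
  have /Ug yi : (i < l)%N by have := ltn_ord i; move: il => /=; lia.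
  have : y 0 i != 0 by rewrite gt_eqF// (le_lt_trans _ yi).
  have := congr1 (fun v : 'rV[R]_n => v 0 i) E; rewrite /y !sactE E1.
  rewrite mulf_eq0 negb_or => /[swap] /andP[_ x0] /(mulIf x0).
  exact: signr_inj.
case: g h og oh E1 E2 {y E Ug Ch inj_abs} => [s A] [s' B] /= oA oB -> E2.
congr pair; apply/finset.setP => i; have [->|/E2//] := eqVneq i l.
have : odd #|A| = odd #|B| by rewrite (negbTE oA) (negbTE oB).
rewrite !odd_cards (bigD1 l)// (bigD1 (F := fun i => i \in B) l)//=.
by rewrite (eq_bigr (fun i => i \in B))// => /addIb.
Qed.

(** Sort by absolute value and make all coordinates nonnegative; if this takes an
    odd number of sign changes, change the last sign once more. *)
Lemma chamberD_exists x :
  exists g, ~~ odd #|g.2| /\ chamberD (sact g x).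
Proof.
have [s Hs] : exists s : 'S_n, forall i j : 'I_n,
    (i <= j)%N -> `|x 0 (s j)| <= `|x 0 (s i)|.
  pose f := fun i => `|x 0 i|.
  have /tuple_permP[s Es] : perm_eq (sort >=%R (abs_seq x)) [tuple f i | i < n].
    by rewrite perm_sort.
  exists s => i j ij.
  have tr : transitive (@Order.ge _ R) by exact: ge_trans.
  have srt : sorted >=%R (sort >=%R (abs_seq x)).
    by apply: sort_sorted => a b; exact: le_total.
  have sz : size (sort >=%R (abs_seq x)) = n.
    by rewrite size_sort size_map size_enum_ord.
  have := sorted_leq_nth tr (@lexx _ _) 0 srt.
  move=> /(_ i j); rewrite !inE sz => /(_ (ltn_ord i) (ltn_ord j) ij).
  rewrite Es.
  by rewrite -!tnth_nth !tnth_map !tnth_ord_tuple /f.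
have n1 : (n.-1 < n)%N by lia.
pose l := Ordinal n1.
(* toggling membership of the last index l makes the number of sign changes even *)
pose E0 := [set i | x 0 (s i) < 0]%SET.
pose E := [set i | (i \in E0) (+) ((i == l) && odd #|E0|)]%SET.
have oE : ~~ odd #|E|.
  rewrite odd_cards; under eq_bigr do rewrite finset.inE.
  rewrite big_split /= -odd_cards.
  rewrite (bigD1 l)//= eqxx /= big1 ?addbF ?addbb// => i /negbTE ->.
  by [].
exists (s, E); split=> //; apply/(chamberDP n2) => a b ab.
rewrite norm_sact /= (le_trans (Hs a b (ltnW ab)))//.
rewrite sactE /= finset.inE.
have -> : (a == l) = false.
  by apply/negbTE; rewrite -val_eqE /=; have := ltn_ord b; lia.
rewrite addbF finset.inE; case: ltP => xa.
  by rewrite ltr0_norm// expr1 mulN1r.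
by rewrite ger0_norm// expr0 mul1r.
Qed.

(** Existence and uniqueness turn an event about the folded point into a finite
    union of events about x, which makes it measurable. *)
Lemma foldDP x (A : set 'rV[R]_n) :
  A (foldD x) <-> exists2 g : 'S_n * {set 'I_n},
    ~~ odd #|g.2| & (A `&` chamberD) (sact g x).
Proof.
have [g0 [og0 Cg0]] := chamberD_exists x.
have [g og [Eg Cg]] : exists2 g : 'S_n * {set 'I_n}, ~~ odd #|g.2| &
    foldD x = sact g x /\ chamberD (sact g x).
  have : (chamberD `&` orbitD x) (foldD x).
    by apply: xgetPex; exists (sact g0 x); split=> //; apply/orbitDP; exists g0.
  by move=> [C /orbitDP[g [og E]]]; exists g => //; rewrite -E.
rewrite Eg; split=> [Ag|[h oh [Ah Ch]]]; first by exists g.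
by rewrite (chamberD_unique og oh Cg Ch).
Qed.

End chamber_orbit.

(** * Walls, antisymmetric functions and Lipschitz approximation *)

Section antisymmetrization.
Context {R : realType} {n : nat}.
Implicit Types (x y : 'rV[R]_n) (g : 'S_n * {set 'I_n}) (f h : 'rV[R]_n -> R).

Definition antisym f x : R :=
  \sum_(g : 'S_n * {set 'I_n} | ~~ odd #|g.2|) (-1) ^+ odd_perm g.1 * f (sact g x).

(** The reflection that exchanges x_a with x_b, or x_a with - x_b when e is true.
    Its fixed hyperplane is the zero set of the linear form [rootD]. *)
Definition reflD (a b : 'I_n) (e : bool) : 'S_n * {set 'I_n} :=
  (tperm a b, if e then [set a; b]%SET else finset.set0).

Definition rootD (a b : 'I_n) (e : bool) x : R := x 0 a - (-1) ^+ e * x 0 b.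

Lemma in_reflD a b e i : (i \in (reflD a b e).2) = e && ((i == a) || (i == b)).
Proof. by rewrite /reflD /=; case: e; rewrite ?finset.inE. Qed.

Lemma compD_reflK a b e : involutive (fun g => compD g (reflD a b e)).
Proof.
move=> [s E]; rewrite /compD; congr pair => /=.
  by rewrite -mulgA tperm2 mulg1.
apply/finset.setP => i; rewrite !finset.inE /= permM -!/(reflD a b e).2 !in_reflD.
have -> : ((tperm a b (s i) == a) || (tperm a b (s i) == b)) =
          ((s i == a) || (s i == b)).
  by case: tpermP => [->|->|_ _]; rewrite ?eqxx ?orbT.
by rewrite -addbA addbb addbF.
Qed.

Lemma odd_reflD a b e : a != b -> odd #|(reflD a b e).2| = false.
Proof. by move=> ab; rewrite /reflD /=; case: e; rewrite ?cards2 ?ab ?cards0. Qed.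

(** Multiplication by a reflection is a bijection of the group that flips the sign
    of the permutation part. *)
Lemma antisym_refl f a b e x : a != b ->
  antisym f (sact (reflD a b e) x) = - antisym f x.
Proof.
move=> ab; rewrite /antisym.
rewrite (reindex_inj (inv_inj (compD_reflK a b e))) -sumrN.
apply: eq_big => g; first by rewrite odd_compD odd_reflD// addbF.
move=> _; rewrite sact_comp compD_reflK /= odd_permM odd_tperm ab addbT.
by rewrite signrN mulNr.
Qed.

(** Only the coordinates a and b move, each of them by the value of the root up to
    sign. *)
Lemma dist_reflD a b e x i :
  `|x 0 i - sact (reflD a b e) x 0 i| <= `|rootD a b e x|.
Proof.
rewrite sactE in_reflD /rootD /=; case: tpermP => [->|->|/eqP ia /eqP ib].
- by rewrite eqxx andbT.
- rewrite eqxx orbT andbT; case: e; last by rewrite !expr0 !mul1r distrC.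
  by rewrite expr1 !mulN1r !opprK addrC.
- by rewrite (negbTE ia) (negbTE ib) andbF expr0 mul1r subrr normr0.
Qed.

(** Lipschitz for the sup distance.  Quantifying over the bound M of the coordinates
    keeps the norm of row vectors out of the computations. *)
Definition coord_lipschitz (L : R) f := forall x y M,
  0 <= M -> (forall i, `|x 0 i - y 0 i| <= M) -> `|f x - f y| <= L * M.

Lemma lipschitz_antisym L f : coord_lipschitz L f ->
  coord_lipschitz (\sum_(g : 'S_n * {set 'I_n} | ~~ odd #|g.2|) L) (antisym f).
Proof.
move=> fL x y M M0 xyM; rewrite /antisym -sumrB mulr_suml.
apply: (le_trans (ler_norm_sum _ _ _)); apply: ler_sum => g _.
rewrite -mulrBr normrM normrX normrN1 expr1n mul1r; apply: fL => // i.
by rewrite !sactE -mulrBr normrM normrX normrN1 expr1n mul1r.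
Qed.

Lemma antisym_bounded f : (forall x, `|f x| <= 1) ->
  forall x, `|antisym f x| <= \sum_(g : 'S_n * {set 'I_n} | ~~ odd #|g.2|) 1.
Proof.
move=> f1 x; apply: (le_trans (ler_norm_sum _ _ _)); apply: ler_sum => g _.
by rewrite normrM normrX normrN1 expr1n mul1r.
Qed.

(** The action is free on the interior of the chamber, so that only the identity
    contributes. *)
Lemma antisym_chamber f x : (2 <= n)%N ->
  (forall y, ~ (chamberD°) y -> f y = 0) -> (chamberD°) x ->
  antisym f x = f x.
Proof.
move=> n2 f0 Ux; rewrite /antisym (bigD1 (1%g, finset.set0)) /=; last first.
  by rewrite cards0.
rewrite sact1 odd_perm1 expr0 mul1r big1 ?addr0// => g /andP[og gN1].
rewrite f0 ?mulr0// => Ug; move: gN1 => /eqP; apply.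
apply: (chamberD_free n2 og _ Ug) => /=; first by rewrite cards0.
by rewrite sact1; exact: interior_subset Ux.
Qed.

Lemma lipschitz_cst c : coord_lipschitz 0 (fun=> c).
Proof. by move=> x y M _ _; rewrite subrr normr0 mul0r. Qed.

Lemma lipschitz_rootD a b e : coord_lipschitz 2 (rootD a b e).
Proof.
move=> x y M M0 xyM; rewrite /rootD.
rewrite (_ : _ - _ - _ = (x 0 a - y 0 a) - (-1) ^+ e * (x 0 b - y 0 b)); last by ring.
rewrite (le_trans (ler_normB _ _))// normrM normrX normrN1 expr1n mul1r.
by rewrite mulr2n mulrDl mul1r lerD.
Qed.

Lemma lipschitz_min L1 L2 f1 f2 : coord_lipschitz L1 f1 ->
  coord_lipschitz L2 f2 ->
  coord_lipschitz (L1 + L2) (fun x => Num.min (f1 x) (f2 x)).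
Proof.
move=> f1L f2L x y M M0 xyM; rewrite mulrDl.
apply: (le_trans _ (lerD (f1L x y M M0 xyM) (f2L x y M M0 xyM))).
move: (f1 x) (f1 y) (f2 x) (f2 y) => a c b e.
case: (lerP a b) => ab; case: (lerP c e) => ce;
  rewrite ler_norml; apply/andP; split;
  have := ler_norm (a - c); have := ler_norm (b - e);
  have := ler_norm (c - a); have := ler_norm (e - b);
  rewrite (distrC c a) (distrC e b);
  have := normr_ge0 (a - c); have := normr_ge0 (b - e); lra.
Qed.

(** A class of open sets closed under intersection, containing the interior of the
    chamber, whose indicators are limits of Lipschitz functions ([ramp_cvg]). *)
Definition lipschitz_open (O : set 'rV[R]_n) := exists h L,
  [/\ measurable_fun setT h, 0 <= L, coord_lipschitz L h &
      O = [set x | 0 < h x]].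

Lemma lipschitz_openT : lipschitz_open setT.
Proof.
exists (fun=> 1), 0; split => //; first exact: lipschitz_cst.
by apply/seteqP; split=> // x _ /=; exact: ltr01.
Qed.

Lemma lipschitz_openI : setI_closed lipschitz_open.
Proof.
move=> A B [f1 [L1 [m1 L10 f1L ->]]] [f2 [L2 [m2 L20 f2L ->]]].
exists (fun x => Num.min (f1 x) (f2 x)), (L1 + L2).
split; [exact: measurable_minr|exact: addr_ge0|exact: lipschitz_min|].
by apply/seteqP; split=> x /=; rewrite lt_min => /andP.
Qed.

Lemma lipschitz_open_lt i c : lipschitz_open [set x | x 0 i < c].
Proof.
exists (fun x => c - x 0 i), 1; split => //.
- by apply: measurable_funB => //; exact: measurable_rV_coord.
- by move=> x y M M0 xyM; rewrite mul1r opprB addrC addrA subrK distrC.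
- by apply/seteqP; split=> x /=; rewrite subr_gt0.
Qed.

Lemma measurable_rootD a b e : measurable_fun setT (rootD a b e).
Proof.
apply: measurable_funB; first exact: measurable_rV_coord.
by apply: measurable_funM => //; exact: measurable_rV_coord.
Qed.

(** The positive roots x_a - x_b and x_a + x_b, a < b, are indexed by (a, b, e). *)
Definition posroot (r : 'I_n * 'I_n * bool) : bool := (r.1.1 < r.1.2)%N.

Definition rootv (r : 'I_n * 'I_n * bool) : 'rV[R]_n -> R :=
  rootD r.1.1 r.1.2 r.2.

Lemma chamberD_rootP x : (2 <= n)%N -> (chamberD°) x <->
  forall r, posroot r -> 0 < rootv r x.
Proof.
move=> n2; rewrite interior_chamberD//; split => [H [[a b] e] /= /H|H a b ab].
  rewrite /rootv /rootD ltr_norml => /andP[].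
  by case: e; rewrite ?expr0 ?expr1 ?mulN1r ?mul1r /=; lra.
have := H (a, b, true) ab; have := H (a, b, false) ab.
by rewrite /rootv /rootD expr0 expr1 ltr_norml mul1r mulN1r => ? ?; apply/andP; lra.
Qed.

Lemma chamberD_closed_rootP x : (2 <= n)%N -> chamberD x <->
  forall r, posroot r -> 0 <= rootv r x.
Proof.
move=> n2; split => [/(chamberDP n2) H [[a b] e] /= /H|H].
  rewrite /rootv /rootD ler_norml => /andP[].
  by case: e; rewrite ?expr0 ?expr1 ?mulN1r ?mul1r /=; lra.
apply/(chamberDP n2) => a b ab.
have := H (a, b, true) ab; have := H (a, b, false) ab.
by rewrite /rootv /rootD expr0 expr1 ler_norml mul1r mulN1r => ? ?; apply/andP; lra.
Qed.

Lemma measurable_chamberD : (2 <= n)%N -> measurable (@chamberD R n).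
Proof.
move=> n2; rewrite (_ : chamberD = \bigcap_(r in [set r | posroot r])
    (rootv r @^-1` `[0, +oo[)); last first.
  apply/seteqP; split=> x.
    by move=> /(chamberD_closed_rootP _ n2) H r /= pr; rewrite in_itv /= andbT H.
  move=> H; apply/(chamberD_closed_rootP _ n2) => r pr.
  by have := H r pr; rewrite /= in_itv /= andbT.
apply: fin_bigcap_measurable => [|r _]; first exact: finite_finset.
by rewrite -[X in measurable X]setTI; apply: measurable_rootD.
Qed.

Lemma lipschitz_open_chamberD : (2 <= n)%N -> lipschitz_open (@chamberD R n)°.
Proof.
move=> n2; rewrite (_ : _° = \big[setI/setT]_(r : 'I_n * 'I_n * bool | posroot r)
    [set x | 0 < rootv r x]); last first.
  apply/seteqP; split=> x.
    by move=> /(chamberD_rootP _ n2) H; elim/big_ind : _ => // r /H.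
  move=> H; apply/(chamberD_rootP _ n2) => r pr.
  by move: H; rewrite (bigD1 r)//= => -[].
elim/big_ind : _ => [|A B|r _].
- exact: lipschitz_openT.
- exact: lipschitz_openI.
- exists (rootv r), 2; split => //; first exact: measurable_rootD.
  exact: lipschitz_rootD.
Qed.

Lemma lipschitz_open_measurable O : lipschitz_open O -> measurable O.
Proof.
move=> [h [L [mh _ _ ->]]]; rewrite -[X in measurable X]setTI.
rewrite (_ : mkset _ = h @^-1` `]0, +oo[); first exact: mh.
by apply/seteqP; split => x /=; rewrite in_itv /= andbT.
Qed.

Lemma lipschitz_open_generates :
  (@measurable _ 'rV[R]_n) `<=` <<s lipschitz_open >>.
Proof.
apply: smallest_sub; first exact: smallest_sigma_algebra.
rewrite -bigcup_seq /= => A [i _ [B mB <-]]; rewrite setTI.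
pose T' := g_sigma_algebraType lipschitz_open.
suff mc : @measurable_fun _ _ T' R setT (fun x : 'rV[R]_n => x 0 i).
  by have := mc measurableT B mB; rewrite setTI.
move=> _; apply: (measurability _ (RGenInftyO.measurableE R)) => //.
move=> _ [_ [c ->] <-]; rewrite setTI; apply: sub_sigma_algebra.
rewrite (_ : _ @^-1` _ = [set x : 'rV[R]_n | x 0 i < c]).
  exact: lipschitz_open_lt.
by apply/seteqP; split=> x; rewrite /= in_itv.
Qed.

(** Lipschitz approximation of the indicator of the set where h is positive; it
    vanishes off that set for every k. *)
Definition ramp (h : 'rV[R]_n -> R) (k : nat) x : R :=
  Num.min 1 (Num.max 0 (k%:R * h x)).

Lemma ramp_bounded h k x : 0 <= ramp h k x <= 1.
Proof. by rewrite /ramp le_min ler01 le_max lexx ge_min lexx. Qed.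

Lemma lipschitz_ramp L h k : coord_lipschitz L h ->
  coord_lipschitz (k%:R * L) (ramp h k).
Proof.
move=> hL x y M M0 xyM; rewrite /ramp -mulrA.
apply: (@le_trans _ _ `|k%:R * h x - k%:R * h y|).
  move: (k%:R * h x) (k%:R * h y) => a b.
  apply: (@le_trans _ _ `|Num.max 0 a - Num.max 0 b|).
    move: (Num.max 0 a) (Num.max 0 b) => {}a {}b.
    have := ler_norm (a - b); have := ler_norm (b - a); rewrite distrC.
    by case: (lerP 1 a) => a1; case: (lerP 1 b) => b1 *; rewrite ler_norml; lra.
  have := ler_norm (a - b); have := ler_norm (b - a); rewrite distrC.
  by case: (lerP 0 a) => a0; case: (lerP 0 b) => b0 *; rewrite ler_norml; lra.
by rewrite -mulrBr normrM ger0_norm// ler_wpM2l// hL.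
Qed.

Lemma measurable_ramp h k : measurable_fun setT h ->
  measurable_fun setT (ramp h k).
Proof.
move=> mh; apply: measurable_minr => //; apply: measurable_maxr => //.
exact: measurable_funM.
Qed.

Lemma ramp0 h k x : ~ (0 < h x) -> ramp h k x = 0.
Proof.
move=> /negP; rewrite -leNgt => h0; rewrite /ramp max_l ?min_r//.
by rewrite mulr_ge0_le0.
Qed.

Lemma ramp_cvg h x : ramp h k x @[k --> \oo] --> (\1_[set y | 0 < h y] x : R).
Proof.
apply: cvg_near_cst; have [h0|h0] := boolP (0 < h x).
  near=> k; rewrite /ramp indicE mem_set//= min_l//.
  rewrite le_max; apply/orP; right; rewrite -ler_pdivrMr// mul1r.
  by near: k; exact: nbhs_infty_ger.
by apply: nearW => k; rewrite indicE memNset//= ?ramp0//; exact/negP.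
Unshelve. all: by end_near. Qed.

End antisymmetrization.

(** * Measures determined on a pi-system *)

Section measure_tools.
Context {R : realType}.

Lemma cvg_bigsum (T : Type) (F : set_system T) (FF : Filter F) (I : Type)
    (r : seq I) (Q : pred I) (u : I -> T -> R) (l : I -> R) :
  (forall i, Q i -> u i x @[x --> F] --> l i) ->
  \sum_(i <- r | Q i) u i x @[x --> F] --> \sum_(i <- r | Q i) l i.
Proof.
move=> ul; elim: r => [|i r IH].
  rewrite big_nil (_ : (fun x => _) = cst 0); first exact: cvg_cst.
  by apply/funext => x; rewrite big_nil.
rewrite big_cons; under eq_fun do rewrite big_cons.
by case: ifP => // /ul ?; exact: cvgD.
Qed.

Lemma cvg_bigprod (T : Type) (F : set_system T) (FF : Filter F) (I : Type)
    (r : seq I) (Q : pred I) (u : I -> T -> R) (l : I -> R) :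
  (forall i, Q i -> u i x @[x --> F] --> l i) ->
  \prod_(i <- r | Q i) u i x @[x --> F] --> \prod_(i <- r | Q i) l i.
Proof.
move=> ul; elim: r => [|i r IH].
  rewrite big_nil (_ : (fun x => _) = cst 1); first exact: cvg_cst.
  by apply/funext => x; rewrite big_nil.
rewrite big_cons; under eq_fun do rewrite big_cons.
by case: ifP => // /ul ?; exact: cvgM.
Qed.

Section signed_unique.
Context d (T : measurableType d) (I : finType) (Q : pred I).
Variables (m0 : {measure set T -> \bar R}) (mu : I -> {measure set T -> \bar R}).
Variables (c : I -> R) (G : set (set T)).
Hypotheses (GI : setI_closed G) (GT : G setT) (mG : G `<=` measurable).
Hypothesis m0_fin : (m0 setT < +oo)%E.
Hypothesis mu_fin : forall i, (mu i setT < +oo)%E.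
Hypothesis m0G : forall A, G A -> fine (m0 A) = \sum_(i | Q i) c i * fine (mu i A).

Let fin (m : {measure set T -> \bar R}) A : (m setT < +oo)%E -> measurable A ->
  (m A < +oo)%E.
Proof. by move=> mT mA; apply: le_lt_trans mT; apply: le_measure; rewrite ?inE. Qed.

Let fineD (m : {measure set T -> \bar R}) A B : (m setT < +oo)%E ->
  measurable A -> measurable B -> B `<=` A ->
  fine (m (A `\` B)) = fine (m A) - fine (m B).
Proof.
move=> mT mA mB BA; rewrite measureD//; last exact: fin.
by rewrite setIidr// fineB// ge0_fin_numE//; exact: fin.
Qed.

Let fine_cvg_mu (m : {measure set T -> \bar R}) (F : nat -> set T) :
  (m setT < +oo)%E -> (forall k, measurable (F k)) -> nondecreasing_seq F ->
  fine (m (F k)) @[k --> \oo] --> fine (m (\bigcup_k F k)).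
Proof.
move=> mT mF ndF; have mUF : measurable (\bigcup_k F k) by exact: bigcupT_measurable.
apply: fine_cvg; rewrite fineK; last by rewrite ge0_fin_numE//; exact: fin.
exact: nondecreasing_cvg_mu.
Qed.

(** Both sides are additive for proper differences and continuous along increasing
    unions, so the sets on which they agree form a lambda-system; the coefficients
    may have either sign. *)
Lemma signed_measure_unique A : <<s G >> A ->
  fine (m0 A) = \sum_(i | Q i) c i * fine (mu i A).
Proof.
pose H : set (set T) :=
  [set B | measurable B /\ fine (m0 B) = \sum_(i | Q i) c i * fine (mu i B)].
suff lH : lambda_system setT H.
  suff : <<s G >> `<=` H by move=> GH /GH[].
  apply: lambda_system_subset => // B GB; split; [exact: mG|exact: m0G].
split => //.
- by split; [exact: measurableT|exact: m0G].
- move=> B D DB [mB EB] [mD ED]; split; first exact: measurableD.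
  rewrite fineD// EB ED -sumrB; apply: eq_bigr => i _.
  by rewrite fineD// mulrBr.
- move=> F ndF HF.
  have mF k : measurable (F k) by have [] := HF k.
  split; first exact: bigcupT_measurable.
  have c0 := fine_cvg_mu m0_fin mF ndF.
  have c1 : \sum_(i | Q i) c i * fine (mu i (F k)) @[k --> \oo] -->
      \sum_(i | Q i) c i * fine (mu i (\bigcup_k F k)).
    by apply: cvg_bigsum => i _; apply: cvgMr; exact: fine_cvg_mu.
  rewrite (_ : (fun k => _) = fun k => \sum_(i | Q i) c i * fine (mu i (F k))) in c0.
    by rewrite -(cvg_lim (@Rhausdorff R) c1); exact/esym/(cvg_lim (@Rhausdorff R) c0).
  by apply/funext => k; have [] := HF k.
Qed.

End signed_unique.

Section law_on.
Context d d' (Omega : measurableType d) (T : measurableType d').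
Variables (P : probability Omega R) (B : set Omega) (phi : Omega -> T).
Hypotheses (mB : measurable B) (mphi : measurable_fun setT phi).

(** The law of phi restricted to the event B.  The measurability proofs are
    arguments of the definition, so that the measure structure can be inferred from
    the term. *)
Definition law_on (A : set T) : \bar R :=
  let _ := mB in let _ := mphi in P (B `&` phi @^-1` A).

Let mphiA A : measurable A -> measurable (B `&` phi @^-1` A).
Proof.
move=> mA; apply: measurableI => //.
by rewrite -[X in measurable X]setTI; exact: mphi.
Qed.

Let law_on0 : law_on set0 = 0%E.
Proof. by rewrite /law_on preimage_set0 setI0 measure0. Qed.

Let law_on_ge0 A : (0 <= law_on A)%E. Proof. exact: measure_ge0. Qed.

Let law_on_sigma : semi_sigma_additive law_on.
Proof.
move=> F mF tF mUF; rewrite /law_on preimage_bigcup setI_bigcupr.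
apply: measure_semi_sigma_additive => //.
- by move=> k; exact: mphiA.
- move=> i j _ _ [w [[_ Fi] [_ Fj]]].
  by apply: tF => //; exists (phi w).
- by apply: bigcupT_measurable => k; exact: mphiA.
Qed.

HB.instance Definition _ := isMeasure.Build _ _ _ law_on law_on0 law_on_ge0
  law_on_sigma.

End law_on.

Section density_measure.
Context d (T : measurableType d) (mu : {measure set T -> \bar R}).
Variable f : T -> R.
Hypotheses (mf : measurable_fun setT f) (f0 : forall x, 0 <= f x).

(** As for [law_on], the proofs are kept in the term for the sake of inference. *)
Definition density_measure (A : set T) : \bar R :=
  let _ := mf in let _ := f0 in (\int[mu]_(x in A) (f x)%:E)%E.

Let dens0 : density_measure set0 = 0%E.
Proof. exact: integral_set0. Qed.

Let dens_ge0 A : (0 <= density_measure A)%E.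
Proof. by apply: integral_ge0 => x _; rewrite lee_fin. Qed.

Let dens_sigma : semi_sigma_additive density_measure.
Proof.
by apply: semi_sigma_additive_nng_induced => //; exact/measurable_EFinP.
Qed.

HB.instance Definition _ := isMeasure.Build _ _ _ density_measure dens0
  dens_ge0 dens_sigma.

End density_measure.

End measure_tools.

(** * Gaussian vectors *)

Section normal_affine.
Context {R : realType}.
Implicit Types (m s a b : R) (e : bool).

Let affine m e (z : measurableTypeR R) : measurableTypeR R := m + (-1) ^+ e * z.

Let measurable_affine m e : measurable_fun setT (affine m e).
Proof. by apply: measurable_funD => //; exact: measurable_funM. Qed.

Let lebesgue_affine m e (A : set R) : measurable A ->
  pushforward lebesgue_measure (affine m e) A = lebesgue_measure A.
Proof.
move=> mA; apply/esym/lebesgue_measure_unique => // _ [[a b] _ <-].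
rewrite /= /pushforward; case: e => /=.
- rewrite (_ : _ @^-1` _ = `[m - b, m - a[%classic).
    rewrite !lebesgue_measure_itv /= !lte_fin ltrD2l ltrN2.
    by case: ifP => // _; rewrite -!EFinB; congr EFin; lra.
  apply/seteqP; split => z /=; rewrite /affine !in_itv /= expr1 mulN1r => /andP[? ?];
    by apply/andP; split; lra.
- rewrite (_ : _ @^-1` _ = `]a - m, b - m]%classic).
    rewrite !lebesgue_measure_itv /= !lte_fin ltrD2r.
    by case: ifP => // _; rewrite -!EFinB; congr EFin; lra.
  apply/seteqP; split => z /=; rewrite /affine !in_itv /= expr0 mul1r => /andP[? ?];
    by apply/andP; split; lra.
Qed.

(** Lebesgue measure is invariant under translations and under the change of sign,
    and the centered normal density is even. *)
Lemma normal_affine m s e (A : set R) : s != 0 -> measurable A ->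
  normal_prob 0 s [set z | A (m + (-1) ^+ e * z)] = normal_prob m s A.
Proof.
move=> s0 mA; rewrite /normal_prob.
have mf : measurable_fun (A : set (measurableTypeR R)) (fun x => (normal_pdf m s x)%:E).
  by apply: measurable_funTS; apply/measurable_EFinP; exact: measurable_normal_pdf.
have f0 : {in (A : set (measurableTypeR R)), forall x, (0 <= (normal_pdf m s x)%:E)%E}.
  by move=> x _; rewrite lee_fin; exact: normal_pdf_ge0.
have E := @ge0_integral_pushforward _ _ _ _ R _ (measurable_affine m e)
  lebesgue_measure A _ mA mf f0.
apply: etrans; last first.
  apply: etrans; first exact: (esym E).
  by apply: eq_measure_integral => B mB _; exact: lebesgue_affine.
apply: eq_integral => z _ /=; congr EFin.
rewrite /affine (normal_pdfE _ s0) (normal_pdfE _ s0).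
rewrite /= /normal_fun /=.
have -> : m + (-1) ^+ e * z - m = (-1) ^+ e * (z - 0) by rewrite subr0; ring.
by rewrite exprMn sqrr_sign mul1r.
Qed.
End normal_affine.

Section integral_product.
Context {R : realType}.

(** Tonelli, one coordinate at a time. *)
Lemma integral_lebesgue_rV_prod n (f : 'I_n -> R -> R) :
  (forall i, measurable_fun setT (f i)) -> (forall i x, 0 <= f i x) ->
  (\int[lebesgue_rV n]_x (\prod_i f i (x 0 i))%:E =
   \prod_i \int[lebesgue_measure]_x (f i x)%:E)%E.
Proof.
elim: n f => [|n IH] f mf f0.
  rewrite big_ord0 /=; under eq_integral do rewrite big_ord0.
  by rewrite integral_cst//= mul1e diracT.
have mprod m (h : 'I_m -> R -> R) : (forall i, measurable_fun setT (h i)) ->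
    measurable_fun setT (fun x : 'rV[R]_m => (\prod_i h i (x 0 i))%:E).
  move=> mh; apply/measurable_EFinP; apply: measurable_prod => i _.
  by apply: (measurableT_comp (mh i)); exact: measurable_rV_coord.
rewrite big_ord_recl -IH//=.
rewrite /lebesgue_rV_step ge0_integral_pushforward//=; first last.
- by move=> x _; rewrite lee_fin prodr_ge0.
- exact: mprod.
- exact: measurable_cons_rV.
rewrite preimage_setT.
pose F (p : measurableTypeR R * 'rV[R]_n) :=
  ((f ord0 p.1)%:E * (\prod_(i < n) f (lift ord0 i) (p.2 0 i))%:E
    : \bar R)%E.
transitivity (\int[lebesgue_measure \x lebesgue_rV n]_p F p)%E.
  apply: eq_integral => p _; rewrite /F /= -EFinM big_ord_recl cons_rV_ord0.
  by congr (_ * _)%:E; apply: eq_bigr => i _; rewrite cons_rV_lift.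
rewrite (@fubini_tonelli1 _ _ _ _ _ lebesgue_measure (lebesgue_rV n) F)//=.
- rewrite -ge0_integralZr//=; last 3 first.
  + by apply/measurable_EFinP; exact: mf.
  + by move=> x _; rewrite lee_fin.
  + by apply: integral_ge0 => x _; rewrite lee_fin prodr_ge0.
  apply: eq_integral => x _; rewrite /fubini_F /F /= ge0_integralZl//=.
  + exact: (mprod n (fun i => f (lift ord0 i)) (fun i => mf _)).
  + by move=> y _; rewrite lee_fin prodr_ge0.
  + by rewrite lee_fin.
- apply: emeasurable_funM.
    apply/measurable_EFinP; apply: (measurableT_comp (mf ord0)).
    exact: measurable_fst.
  apply: (measurableT_comp (mprod n (fun i => f (lift ord0 i)) (fun i => mf _))).
  exact: measurable_snd.
- by move=> p; rewrite /F mule_ge0// lee_fin// prodr_ge0.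
Qed.

Lemma measurable_box n (A : 'I_n -> set R) : (forall i, measurable (A i)) ->
  measurable [set x : 'rV[R]_n | forall i, A i (x 0 i)].
Proof.
move=> mA; rewrite (_ : mkset _ = \bigcap_(i in [set: 'I_n])
    ((fun x : 'rV[R]_n => x 0 i) @^-1` A i)); last first.
  by apply/seteqP; split=> x Bx i; [move=> _|]; exact: Bx.
apply: fin_bigcap_measurable => // i _.
by rewrite -[X in measurable X]setTI; exact: measurable_rV_coord.
Qed.

Lemma integral_lebesgue_rV_box n (f : 'I_n -> R -> R) (A : 'I_n -> set R) :
  (forall i, measurable (A i)) ->
  (forall i, measurable_fun setT (f i)) -> (forall i x, 0 <= f i x) ->
  (\int[lebesgue_rV n]_(x in [set x : 'rV[R]_n | forall i, A i (x 0 i)%R])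
     (\prod_i f i (x 0 i))%:E =
   \prod_i \int[lebesgue_measure]_(x in A i) (f i x)%:E)%E.
Proof.
move=> mA mf f0; rewrite integral_mkcond.
rewrite [RHS](eq_bigr (fun i => \int[lebesgue_measure]_x
    (if x \in A i then f i x else 0)%:E)%E) => [|i _]; last first.
  rewrite integral_mkcond; apply: eq_integral => x _.
  by rewrite patchE; case: ifP.
rewrite -(integral_lebesgue_rV_prod (f := fun i x => if x \in A i then f i x else 0)).
- apply: eq_integral => x _; rewrite patchE.
  have [Ax|nAx] := boolP (x \in _).
    congr EFin; apply: eq_bigr => i _.
    by move: Ax; rewrite inE /= => /(_ i) Ai; rewrite mem_set.
  have [i nAi] : exists i, ~ A i (x 0 i).
    by apply/existsNP => H; move/negP: nAx; apply; rewrite inE.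
  by rewrite (bigD1 i)//= memNset// mul0r.
- move=> i; rewrite (_ : (fun x => _) = f i \_ (A i)); last first.
    by apply/funext => x; rewrite patchE.
  by apply/(measurable_restrictT _ _).1 => //; exact: measurable_funTS.
- by move=> i x; case: ifP.
Qed.

Definition boxes n : set (set 'rV[R]_n) :=
  [set B | exists A : 'I_n -> set R, (forall i, measurable (A i)) /\
     B = [set x : 'rV[R]_n | forall i, A i (x 0 i)]].

Lemma box_generates n : (@measurable _ 'rV[R]_n) `<=`
  <<s @boxes n >>.
Proof.
apply: smallest_sub; first exact: smallest_sigma_algebra.
rewrite -bigcup_seq /= => A [i _ [B mB <-]]; rewrite setTI.
apply: sub_sigma_algebra; exists (fun j => if j == i then B else setT); split.
  by move=> j; case: ifP.
apply/seteqP; split=> x /=; first by move=> Bx j; case: eqP => // ->.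
by move/(_ i); rewrite eqxx.
Qed.

Lemma box_setI n : setI_closed (@boxes n).
Proof.
move=> _ _ [A [mA ->]] [B [mB ->]]; exists (fun i => A i `&` B i); split.
  by move=> i; exact: measurableI.
apply/seteqP; split=> x /=; first by move=> [Ax Bx] i; split.
by move=> AB; split=> i; have [] := AB i.
Qed.
End integral_product.

Section gaussian_law.
Context {R : realType} {d} {Omega : measurableType d}.
Variables (P : probability Omega R) (n : nat).
Implicit Types (g : 'S_n * {set 'I_n}) (s : R).

Definition gauss_density s (m x : 'rV[R]_n) : R :=
  \prod_i normal_pdf (m 0 i) s (x 0 i).

Lemma gauss_density_ge0 s m x : 0 <= gauss_density s m x.
Proof. by apply: prodr_ge0 => i _; exact: normal_pdf_ge0. Qed.

Lemma measurable_gauss_density s m : measurable_fun setT (gauss_density s m).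
Proof.
apply: measurable_prod => i _.
apply: (measurableT_comp (measurable_normal_pdf _ _)).
exact: measurable_rV_coord.
Qed.

Lemma measurable_sact g : measurable_fun setT (@sact R n g).
Proof.
apply/measurable_fun_rVP => i.
rewrite (_ : (fun x => _) = fun x : 'rV[R]_n => (-1) ^+ (i \in g.2) * x 0 (g.1 i)).
  by apply: measurable_funM => //; exact: measurable_rV_coord.
by apply/funext => x; rewrite sactE.
Qed.

Lemma measurable_addrV d' (T : measurableType d') (f1 f2 : T -> 'rV[R]_n) :
  measurable_fun setT f1 -> measurable_fun setT f2 ->
  measurable_fun setT (fun w => f1 w + f2 w).
Proof.
move=> /measurable_fun_rVP m1 /measurable_fun_rVP m2.
apply/measurable_fun_rVP => i.
rewrite (_ : (fun x => _) = fun x => f1 x 0 i + f2 x 0 i); last first.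
  by apply/funext => x; rewrite mxE.
exact: measurable_funD.
Qed.

Lemma measurable_opprV d' (T : measurableType d') (f1 : T -> 'rV[R]_n) :
  measurable_fun setT f1 -> measurable_fun setT (fun w => - f1 w).
Proof.
move=> /measurable_fun_rVP m1; apply/measurable_fun_rVP => i.
rewrite (_ : (fun x => _) = fun x => - f1 x 0 i); last first.
  by apply/funext => x; rewrite mxE.
exact: measurable_funN.
Qed.

Variables (W : Omega -> 'rV[R]_n) (s : R) (x0 : 'rV[R]_n).
Hypothesis s0 : s != 0.
Hypothesis mW : measurable_fun setT W.
Hypothesis indepW : mutually_independent P (fun (i : 'I_n) w => W w 0 i).
Hypothesis gaussW : forall (i : 'I_n) (A : set R), measurable A ->
  P [set w | A (W w 0 i)] = normal_prob 0 s A.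

Let Y g w := sact g (x0 + W w).

Let mY g : measurable_fun setT (Y g).
Proof.
apply: (measurableT_comp (measurable_sact g)).
by apply: measurable_addrV => //; exact: measurable_cst.
Qed.

(** Each coordinate of g (x0 + W) is, up to a shift and a sign, one coordinate of W,
    and distinct coordinates come from distinct ones. *)
Lemma gauss_box g (A : 'I_n -> set R) : (forall i, measurable (A i)) ->
  P [set w | forall i, A i (sact g (x0 + W w) 0 i)] =
  (\prod_i normal_prob (sact g x0 0%R i)%R s (A i))%E.
Proof.
move=> mA; pose e i := i \in g.2.
pose B k := let i := ((g.1^-1)%g : 'S_n) k in
  [set z | A i (sact g x0 0 i + (-1) ^+ e i * z)].
have mB k : measurable (B k).
  rewrite /B /=; set i := _ k; rewrite -[X in measurable X]setTI.
  have : measurable_fun setT (fun z : R => sact g x0 0 i + (-1) ^+ e i * z).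
    by apply: measurable_funD => //; exact: measurable_funM.
  by apply.
rewrite (_ : mkset _ = [set w | forall k, B k (W w 0 k)]).
  rewrite indepW//.
  rewrite (reindex_inj (@perm_inj _ g.1)) /=; apply: eq_bigr => i _.
  rewrite gaussW// /B /= permK.
  by rewrite normal_affine.
apply/seteqP; split=> w /= H.
  move=> k; have := H ((g.1^-1)%g k).
  by rewrite /B /= !sactE !mxE permKV mulrDr.
move=> i; have := H (g.1 i).
by rewrite /B /= !sactE !mxE permK mulrDr.
Qed.

(** Both sides are finite measures in B, equal on boxes. *)
Lemma gauss_law g (B : set 'rV[R]_n) : measurable B ->
  P [set w | B (sact g (x0 + W w))] =
  (\int[lebesgue_rV n]_(x in B) (gauss_density s (sact g x0) x)%:E)%E.
Proof.
move=> mB.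
pose m1 : {measure set 'rV[R]_n -> \bar R} := law_on P measurableT (mY g).
pose m2 : {measure set 'rV[R]_n -> \bar R} :=
  density_measure (lebesgue_rV n) (measurable_gauss_density s (sact g x0))
  (gauss_density_ge0 s (sact g x0)).
have m1E C : m1 C = P [set w | C (sact g (x0 + W w))].
  by rewrite /m1 /= /law_on setTI.
have m12 : m1 B = m2 B; last by rewrite -m1E m12.
have boxT : @boxes R n setT.
  by exists (fun=> setT); split=> //; apply/seteqP; split.
have GE := @g_sigma_algebra_measure_unique _ R 'rV[R]_n (@boxes R n) _
  (fun=> setT) (fun=> boxT) _ m1 m2 (@box_setI R n).
apply: GE; last exact: box_generates.
- by move=> _ [A [mA ->]]; exact: measurable_box.
- by apply/seteqP; split=> // x _; exists 0%N.
- move=> _ [A [mA ->]]; rewrite m1E gauss_box// /m2 /= /density_measure.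
  apply/esym; apply: (@integral_lebesgue_rV_box R n
    (fun i => normal_pdf (sact g x0 0 i) s) A) => //.
  + by move=> i; exact: measurable_normal_pdf.
  + by move=> i x; exact: normal_pdf_ge0.
- move=> _; rewrite m1E; apply: le_lt_trans (ltry 1); apply: probability_le1.
  exact: measurableT.
Qed.

(** The joint law of two distinct coordinates is a product of two laws without atoms,
    and every vertical section of the line x = y or x = - y is a point. *)
Lemma gauss_no_tie g a b e : a != b ->
  P [set w | rootD a b e (sact g (x0 + W w)) = 0] = 0%E.
Proof.
move=> ab; set y := sact g x0.
pose RR := (measurableTypeR R * measurableTypeR R)%type.
pose phi w : RR := (Y g w 0 a, Y g w 0 b).
have mphi : measurable_fun setT phi.
  apply/measurable_fun_pairP; split => /=.
    exact: (measurableT_comp (measurable_rV_coord a) (mY g)).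
  exact: (measurableT_comp (measurable_rV_coord b) (mY g)).
pose D : set RR := [set p | p.1 - (-1) ^+ e * p.2 = 0].
have mD : measurable D.
  rewrite -[X in measurable X]setTI.
  have : measurable_fun setT (fun p : RR => p.1 - (-1) ^+ e * p.2).
    apply: measurable_funB; first exact: measurable_fst.
    by apply: measurable_funM => //; exact: measurable_snd.
  by move=> /(_ measurableT _ (measurable_set1 0)); apply.
transitivity (law_on P measurableT mphi D); first by rewrite /law_on setTI.
rewrite -(@product_measure_unique _ _ _ _ R (normal_prob (y 0 a) s)
  (normal_prob (y 0 b) s) (law_on P measurableT mphi) _ D mD).
- rewrite /product_measure1 /=; apply: integral0_eq => x _ /=.
  rewrite (_ : xsection D x = [set (-1) ^+ e * x]).
    by rewrite /normal_prob integral_set1.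
  rewrite xsectionE; apply/seteqP; split=> z /=; rewrite /D /=.
    by move=> /eqP; rewrite subr_eq0 => /eqP ->; rewrite mulrA -expr2 sqrr_sign mul1r.
  by move=> ->; rewrite mulrA -expr2 sqrr_sign mul1r subrr.
- move=> A B mA mB; rewrite /= /law_on setTI.
  pose C i := if i == a then A else if i == b then B else setT.
  have mC i : measurable (C i) by rewrite /C; case: ifP => // _; case: ifP.
  rewrite (_ : _ @^-1` _ = [set w | forall i, C i (sact g (x0 + W w) 0 i)]).
    rewrite gauss_box// (bigD1 a)//= (bigD1 b) /=; last by rewrite eq_sym.
    rewrite /C eqxx eq_sym (negbTE ab) eqxx big1 ?mule1// => i /andP[ia ib].
    by rewrite (negbTE ia) (negbTE ib) probability_setT.
  apply/seteqP; split=> w; rewrite /C /phi /Y /=.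
    by move=> [? ?] i; case: eqP => [->//|_]; case: eqP => [->//|_].
  move=> H; split; first by have := H a; rewrite eqxx.
  by have := H b; rewrite eqxx eq_sym (negbTE ab).
Qed.
End gaussian_law.

(** * Integrals of bounded functions on events *)

Section bounded_integrals.
Context {R : realType} {d} {Omega : measurableType d} (P : probability Omega R).
Implicit Types (f g : Omega -> R) (H : set Omega) (C : R).

Lemma bounded_integrable f C H : measurable H -> measurable_fun setT f ->
  (forall w, `|f w| <= C) -> P.-integrable H (EFin \o f).
Proof.
move=> mH mf fC; apply: measurable_bounded_integrable => //.
- by apply: le_lt_trans (ltry 1); exact: probability_le1.
- exact: measurable_funTS.
- exists C; split; first exact: num_real.
  by move=> M CM w _ /=; exact: le_trans (fC w) (ltW CM).
Qed.

(** The event H is recorded as a second component, the indicator of H, with value in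
    R.  The integral over H then is an integral for a law on T * R, over the set where
    that component equals 1. *)
Lemma Rintegral_law_eq d' (T : measurableType d') (phi1 phi2 : Omega -> T) H
    (F : T -> R) C :
  measurable_fun setT phi1 -> measurable_fun setT phi2 -> measurable H ->
  (forall A, measurable A -> P (H `&` phi1 @^-1` A) = P (H `&` phi2 @^-1` A)) ->
  measurable_fun setT F -> (forall x, `|F x| <= C) ->
  \int[P]_(w in H) F (phi1 w) = \int[P]_(w in H) F (phi2 w).
Proof.
move=> m1 m2 mH E mF FC; congr fine.
pose psi phi w : T * measurableTypeR R := (phi w, \1_H w).
have mpsi phi : measurable_fun setT phi -> measurable_fun setT (psi phi).
  by move=> mphi; apply/measurable_fun_pairP; split => //=; exact: measurable_indic.
pose D : set (T * measurableTypeR R) := setT `*` [set 1].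
have mD : measurable D by apply: measurableX => //; exact: measurable_set1.
have psiD phi : psi phi @^-1` D = H.
  apply/seteqP; split=> w; rewrite /psi /D /= indicE.
    move=> [_]; have [|] := boolP (w \in H); rewrite ?inE// => _ /eqP.
    by rewrite eq_sym oner_eq0.
  by move=> Hw; rewrite mem_set.
pose f (p : T * measurableTypeR R) := (F p.1)%:E.
have mf : measurable_fun setT f.
  by apply/measurable_EFinP; apply: (measurableT_comp mF); exact: measurable_fst.
have key phi (mphi : measurable_fun setT phi) :
    (\int[P]_(w in H) (F (phi w))%:E = \int[pushforward P (psi phi)]_(p in D) f p)%E.
  rewrite (@integral_pushforward _ _ _ _ R _ (mpsi _ mphi) P D f mf) ?psiD//.
  by apply: (@bounded_integrable _ C) => //; exact: (measurableT_comp mF mphi).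
rewrite (key _ m1) (key _ m2); apply: eq_measure_integral;
  [exact: mpsi|exact: mpsi|move=> mp1 mp2 A mA AD].
have preA phi : psi phi @^-1` A = H `&` phi @^-1` (ysection A 1).
  apply/seteqP; split=> w /=.
    move=> Aw; have : D (psi phi w) by exact: AD.
    rewrite -[D _]/((psi phi @^-1` D) w) psiD => Hw; split=> //.
    by move: Aw; rewrite /psi indicE mem_set// ysectionE.
  by move=> [Hw]; rewrite ysectionE /psi indicE mem_set.
by rewrite /= /pushforward !preA E//; exact: measurable_ysection.
Qed.

Lemma Rintegral_setD f C H K : measurable H -> measurable K -> K `<=` H ->
  measurable_fun setT f -> (forall w, `|f w| <= C) ->
  \int[P]_(w in H) f w = \int[P]_(w in K) f w + \int[P]_(w in H `\` K) f w.
Proof.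
move=> mH mK KH mf fC; rewrite -[in LHS](setDUK KH).
have mHK : measurable (H `\` K) by exact: measurableD.
rewrite Rintegral_setU//.
- by rewrite setDUK//; exact: bounded_integrable fC.
- by rewrite disj_set2E setDIK.
Qed.

(** Splitting off one condition at a time writes the complement of the intersection
    as a disjoint union of the events on which condition m is the first to fail. *)
Lemma first_failure f g C (c : nat -> set Omega) (M : nat) :
  measurable_fun setT f -> (forall w, `|f w| <= C) ->
  measurable_fun setT g -> (forall w, 0 <= g w <= C) ->
  (forall m, measurable (c m)) ->
  (forall m, (m < M)%N ->
    let D := \bigcap_(i < m) c i `\` c m in
    `|\int[P]_(w in D) f w| <= \int[P]_(w in D) g w) ->
  `|\int[P]_w f w - \int[P]_(w in \bigcap_(i < M) c i) f w| <= \int[P]_w g w.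
Proof.
move=> mf fC mg gC mc cfail.
have gC' w : `|g w| <= C by have /andP[g0 ?] := gC w; rewrite ger0_norm.
have mcap m : measurable (\bigcap_(i < m) c i).
  by apply: fin_bigcap_measurable => //; exact: finite_II.
suff : `|\int[P]_w f w - \int[P]_(w in \bigcap_(i < M) c i) f w| <=
       \int[P]_(w in setT `\` \bigcap_(i < M) c i) g w.
  move=> /le_trans; apply.
  rewrite (Rintegral_setD measurableT (mcap M) (@subsetT _ _) mg gC').
  by rewrite lerDr Rintegral_ge0// => w _; have /andP[] := gC w.
elim: M cfail => [|M IH] cfail.
  rewrite (_ : \bigcap_(i < 0) c i = setT); last by apply/seteqP; split.
  rewrite subrr normr0 Rintegral_ge0// => w _; by have /andP[] := gC w.
set CM := \bigcap_(i < M) c i in IH *.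
have capS : \bigcap_(i < M.+1) c i = CM `\` (CM `\` c M).
  apply/seteqP; split=> w /=.
    move=> Hw; split=> [i /= iM|[_]]; first by apply: Hw; exact: leqW.
    by apply; apply: Hw => /=; exact: ltnSn.
  move=> [Cw ncw] i /=; rewrite ltnS leq_eqVlt => /predU1P[->|iM]; last exact: Cw.
  by apply: contrapT => ncM; apply: ncw.
set D := CM `\` c M in capS; set CS := \bigcap_(i < M.+1) c i in capS *.
have mD : measurable D by apply: measurableD => //; exact: mcap.
have DC : D `<=` CM by exact: subDsetl.
have := Rintegral_setD (mcap M) mD DC mf fC; rewrite -/CM -capS => EC.
(* the complement of the first M+1 conditions is that of the first M, plus D *)
have -> : setT `\` CS = (setT `\` CM) `|` D.
  rewrite capS setDDr; congr (_ `|` _).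
  by rewrite setTI.
have mTC : measurable (setT `\` CM) by apply: measurableD => //; exact: mcap.
rewrite Rintegral_setU//; last 2 first.
- by apply: bounded_integrable gC' => //; exact: measurableU.
- by apply/disj_setPS => w [[_ nC] [Cw _]].
have {}IH := IH (fun m mM => cfail m (ltnW mM)).
have := cfail M (leqnn _); rewrite /= -/CM -/D => FD.
rewrite (_ : _ - _ = (\int[P]_w f w - \int[P]_(w in CM) f w) + \int[P]_(w in D) f w).
  by rewrite (le_trans (ler_normD _ _))// lerD.
by rewrite EC; ring.
Qed.

End bounded_integrals.

(** * Independence of the past and reflection of the future *)

Section past.
Context {R : realType} {d} {Omega : measurableType d} (P : probability Omega R).
Variables (n : nat) (eta : 'rV[R]_n) (X : R -> Omega -> 'rV[R]_n).
Hypothesis hX : brownian_motion P eta X.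
Variables (s : nat -> R) (j : nat) (t : R).
Hypotheses (s0 : s 0 = 0) (s_mono : forall k, (k < j)%N -> s k <= s k.+1)
  (s_t : s j < t).

(** Events determined by the increments of the path between the times s 0, ..., s j. *)
Definition past_cylinders : set (set Omega) := [set E | exists A : nat -> set 'rV[R]_n,
  (forall i, measurable (A i)) /\
  E = [set w | forall i, (i < j)%N -> A i (X (s i.+1) w - X (s i) w)]].

Definition past_event (E : set Omega) := <<s past_cylinders >> E.

Let s_ge0 i : (i <= j)%N -> 0 <= s i.
Proof.
elim: i => [|i IH] ij; first by rewrite s0.
by rewrite (le_trans (IH (ltnW ij)))// s_mono.
Qed.

Let mX i : (i <= j)%N -> measurable_fun setT (X (s i)).
Proof. by move=> ij; apply: (bm_measurable hX); exact: s_ge0. Qed.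

Let mXt : measurable_fun setT (X t).
Proof. by apply: (bm_measurable hX); rewrite (le_trans (s_ge0 (leqnn j)))// ltW. Qed.

Let W w := X t w - X (s j) w.

Lemma measurable_increment : measurable_fun setT W.
Proof. by apply: measurable_addrV => //; apply: measurable_opprV; exact: mX. Qed.

Let mD i : (i < j)%N -> measurable_fun setT (fun w => X (s i.+1) w - X (s i) w).
Proof.
move=> ij; apply: measurable_addrV; first exact: mX.
by apply: measurable_opprV; apply: mX; exact: ltnW.
Qed.

Lemma past_cylindersI : setI_closed past_cylinders.
Proof.
move=> _ _ [A [mA ->]] [B [mB ->]]; exists (fun i => A i `&` B i); split.
  by move=> i; exact: measurableI.
apply/seteqP; split=> w /=; first by move=> [Aw Bw] i ij; split; [exact: Aw|exact: Bw].
by move=> AB; split=> i ij; have [] := AB i ij.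
Qed.

Lemma past_cylindersT : past_cylinders setT.
Proof. by exists (fun=> setT); split=> //; apply/seteqP; split. Qed.

Lemma past_cylinders_measurable : past_cylinders `<=` measurable.
Proof.
move=> _ [A [mA ->]].
rewrite (_ : mkset _ = \bigcap_(i < j) ((fun w => X (s i.+1) w - X (s i) w) @^-1` A i)).
  apply: fin_bigcap_measurable => [|i ij]; first exact: finite_II.
  by rewrite -[X in measurable X]setTI; exact: mD.
by apply/seteqP; split=> w H i; exact: H.
Qed.

Lemma past_event_measurable E : past_event E -> measurable E.
Proof.
apply: smallest_sub; first exact: sigma_algebra_measurable.
exact: past_cylinders_measurable.
Qed.

(** Independence of the increments is the product rule on cylinders; both sides are
    finite measures in E. *)
Lemma past_indep E D : past_event E -> measurable D ->
  fine (P (E `&` W @^-1` D)) = fine (P E) * fine (P (W @^-1` D)).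
Proof.
move=> pE mD'.
(* the chain s 0 <= ... <= s j < t, whose last increment is W *)
pose c i := if (i <= j)%N then s i else t.
have cE i : (i <= j)%N -> c i = s i by rewrite /c => ->.
have cj : c j.+1 = t by rewrite /c ltnn.
have c_mono k : (k < j.+1)%N -> c k <= c k.+1.
  rewrite ltnS => kj; rewrite cE//; move: kj; rewrite leq_eqVlt => /predU1P[->|kj].
    by rewrite cj ltW.
  by rewrite cE// s_mono.
have cyl (A : nat -> set 'rV[R]_n) D' : (forall i, measurable (A i)) -> measurable D' ->
    P ([set w | forall i, (i < j)%N -> A i (X (s i.+1) w - X (s i) w)] `&` W @^-1` D') =
    (\prod_(i < j) P [set w | A i (X (s i.+1) w - X (s i) w)%R] * P (W @^-1` D'))%E.
  move=> mA mD''.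
  have c0 : 0 <= c 0%N by rewrite cE// s0.
  pose B (k : 'I_j.+1) := if (k < j)%N then A k else D'.
  have mB k : measurable (B k) by rewrite /B; case: ifP.
  have := bm_independent_increments hX c0 c_mono mB.
  rewrite big_ord_recr /= /B ltnn cj cE//.
  rewrite (eq_bigr (fun i : 'I_j => P [set w | A i (X (s i.+1) w - X (s i) w)])) => [<-|i _].
    congr (P _); apply/seteqP; split=> w /= H.
      move=> k; case: ifPn => kj.
        by rewrite !cE ?(ltnW kj)//; exact: H.1.
      have -> : k = j :> nat by apply/eqP; rewrite eqn_leq -ltnS ltn_ord /= leqNgt.
      by rewrite cj cE//; exact: H.2.
    split.
      move=> i ij; have := H (widen_ord (leqnSn j) (Ordinal ij)).
      by rewrite /= ij !cE// ltnW.
    by have := H ord_max; rewrite /= ltnn cj cE.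
  by rewrite (ltn_ord i) !cE ?(ltnW (ltn_ord i)).
have mWD : measurable (W @^-1` D).
  by rewrite -[X in measurable X]setTI; exact: measurable_increment.
pose m0 : {measure set Omega -> \bar R} := law_on P mWD (@measurable_id _ Omega setT).
pose m1 : {measure set Omega -> \bar R} := P.
have m0E B : m0 B = P (B `&` W @^-1` D) by rewrite /m0 /= /law_on preimage_id setIC.
have m1_fin B : measurable B -> (P B < +oo)%E.
  by move=> mB; apply: le_lt_trans (ltry 1); exact: probability_le1.
rewrite -m0E (@signed_measure_unique R _ Omega 'I_1 xpredT m0 (fun=> m1)
  (fun=> fine (P (W @^-1` D))) past_cylinders)//; first by rewrite big_ord1 mulrC.
- exact: past_cylindersI.
- exact: past_cylindersT.
- exact: past_cylinders_measurable.
- by rewrite m0E setTI m1_fin.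
- by move=> _; exact: m1_fin.
move=> _ [A [mA ->]]; rewrite m0E big_ord1.
rewrite cyl//; have := cyl A setT mA measurableT.
rewrite preimage_setT setIT probability_setT mule1 /m1 /= => ->.
rewrite fineM ?fin_num_measure//; last first.
  rewrite prode_fin_num// => i _; rewrite fin_num_measure//.
  by rewrite -[X in measurable X]setTI; exact: mD.
exact: mulrC.
Qed.

(** X (s i) is the starting point plus the sum of the first i increments. *)
Lemma past_event_X i A : (i <= j)%N -> measurable A -> past_event (X (s i) @^-1` A).
Proof.
move=> ij mA.
pose T := g_sigma_algebraType past_cylinders.
suff : @measurable_fun _ _ T 'rV[R]_n setT (X (s i)).
  by move=> /(_ measurableT A mA); rewrite setTI.
elim: i ij => [|i IH] ij.
  rewrite s0 (_ : X 0 = cst eta); first exact: measurable_cst.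
  by apply/funext => w; rewrite (bm_start hX).
rewrite (_ : X (s i.+1) = fun w => X (s i) w + (X (s i.+1) w - X (s i) w)); last first.
  by apply/funext => w; rewrite addrC subrK.
apply: (@measurable_addrV R n _ T); first exact: IH (ltnW ij).
move=> _ B mB; rewrite setTI; apply: sub_sigma_algebra.
exists (fun k => if k == i then B else setT); split.
  by move=> k; case: ifP.
apply/seteqP; split=> w /=; first by move=> Bw k kj; case: eqP => // ->.
by move/(_ _ ij); rewrite eqxx.
Qed.

End past.

Section reflection.
Context {R : realType} {d} {Omega : measurableType d} (P : probability Omega R).
Variables (n : nat) (eta : 'rV[R]_n) (X : R -> Omega -> 'rV[R]_n).
Hypothesis hX : brownian_motion P eta X.
Variables (s : nat -> R) (j : nat) (t : R).
Hypotheses (s0 : s 0 = 0) (s_mono : forall k, (k < j)%N -> s k <= s k.+1)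
  (s_t : s j < t).

Let sj_ge0 : 0 <= s j.
Proof.
suff H i : (i <= j)%N -> 0 <= s i by exact: H.
elim: i => [|i IH] ij; first by rewrite s0.
by rewrite (le_trans (IH (ltnW ij)))// s_mono.
Qed.

Let mX : measurable_fun setT (X (s j)).
Proof. exact: (bm_measurable hX). Qed.

Let W w := X t w - X (s j) w.

Let mW : measurable_fun setT W.
Proof. exact: (measurable_increment hX s0 s_mono s_t). Qed.

Lemma sactD (g : 'S_n * {set 'I_n}) (x y : 'rV[R]_n) :
  sact g (x + y) = sact g x + sact g y.
Proof. by apply/rowP => i; rewrite !mxE mulrDr. Qed.

Lemma sact0 (g : 'S_n * {set 'I_n}) : sact g 0 = 0 :> 'rV[R]_n.
Proof. by apply/rowP => i; rewrite !mxE mulr0. Qed.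

Lemma sact_reflK a b e : involutive (@sact R n (reflD a b e)).
Proof.
move=> x; rewrite sact_comp.
have := compD_reflK a b e (1%g, finset.set0).
move=> /(congr1 (fun g => sact g x)); rewrite -!sact_comp !sact1.
by rewrite sact_comp => {2}<-; rewrite -!sact_comp ?sact1.
Qed.

(** Centered independent normal coordinates of equal variance: the law is invariant
    under signed permutations. *)
Lemma increment_law g D : measurable D ->
  P ((fun w => sact g (W w)) @^-1` D) = P (W @^-1` D).
Proof.
move=> mD; have s1 : Num.sqrt (t - s j) != 0.
  by rewrite gt_eqF// sqrtr_gt0 subr_gt0.
have law := gauss_law 0 s1 mW (bm_independent_coordinates hX sj_ge0 s_t)
  (bm_gaussian_coordinates hX sj_ge0 s_t).
have := law g D mD; have := law (1%g, finset.set0) D mD.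
rewrite !sact0.
under eq_set do rewrite sact1 add0r.
under [in X in _ -> X -> _]eq_set do rewrite add0r.
by rewrite /preimage /= => -> ->.
Qed.

(** The position at time s j, restricted to a past event, is independent of the
    increment W, so replacing W by g W does not change the joint law. *)
Lemma reflected_law g E A : past_event X s j E -> measurable A ->
  P (E `&` (fun w => (X (s j) w, W w)) @^-1` A) =
  P (E `&` (fun w => (X (s j) w, sact g (W w))) @^-1` A).
Proof.
move=> pE mA.
have mE := past_event_measurable hX s0 s_mono pE.
have mgW : measurable_fun setT (fun w => sact g (W w)).
  exact: (measurableT_comp (measurable_sact g)).
have mp1 : measurable_fun setT (fun w => (X (s j) w, W w)).
  exact/measurable_fun_pairP.
have mp2 : measurable_fun setT (fun w => (X (s j) w, sact g (W w))).
  exact/measurable_fun_pairP.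
pose m1 : {measure set ('rV[R]_n * 'rV[R]_n) -> \bar R} := law_on P mE mp1.
pose m2 : {measure set ('rV[R]_n * 'rV[R]_n) -> \bar R} := law_on P mE mp2.
pose G : set (set ('rV[R]_n * 'rV[R]_n)) :=
  [set A `*` B | A in measurable & B in measurable].
have GT : G setT by exists setT => //; exists setT => //; rewrite setXTT.
have GI : setI_closed G.
  move=> _ _ [A1 mA1 [A2 mA2 <-]] [B1 mB1 [B2 mB2 <-]].
  exists (A1 `&` B1); first exact: measurableI.
  by exists (A2 `&` B2); [exact: measurableI|rewrite setXI].
have mG : G `<=` measurable by move=> _ [A1 mA1 [A2 mA2 <-]]; exact: measurableX.
have UE := @g_sigma_algebra_measure_unique _ R _ G mG (fun=> setT) (fun=> GT)
  _ m1 m2 GI.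
apply: (UE _ _ _ A).
- by apply/seteqP; split=> // x _; exists 0%N.
- move=> _ [A1 mA1 [A2 mA2 <-]]; rewrite /m1 /m2 /= /law_on.
  pose E' := E `&` X (s j) @^-1` A1.
  have pE' : past_event X s j E'.
    apply: (@measurableI _ (g_sigma_algebraType (past_cylinders X s j))) => //.
    exact: (past_event_X hX s0 (leqnn j)).
  have mgA2 : measurable (@sact R n g @^-1` A2).
    by rewrite -[X in measurable X]setTI; exact: measurable_sact.
  rewrite (_ : _ `&` _ = E' `&` W @^-1` A2); last by rewrite /E' -setIA.
  rewrite (_ : E `&` _ = E' `&` W @^-1` (@sact R n g @^-1` A2)); last by rewrite /E' -setIA.
  have mE' := past_event_measurable hX s0 s_mono pE'.
  have mWp (D : set 'rV[R]_n) : measurable D -> measurable (E' `&` W @^-1` D).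
    move=> mD; apply: measurableI => //.
    by rewrite -[X in measurable X]setTI; exact: mW.
  rewrite -[LHS]fineK ?fin_num_measure//; last exact: mWp.
  rewrite -[RHS]fineK ?fin_num_measure//; last exact: mWp.
  congr EFin.
  rewrite !(past_indep hX s0 s_mono s_t pE')//.
  by rewrite -(increment_law g mA2).
- move=> _; rewrite /m1 /=; apply: le_lt_trans (ltry 1).
  by apply: probability_le1; rewrite preimage_setT setIT.
- by rewrite -measurable_prod_measurableType.
Qed.

Variables (F : 'rV[R]_n -> R) (C L : R).
Hypotheses (mF : measurable_fun setT F) (FC : forall x, `|F x| <= C)
  (FL : coord_lipschitz L F).

(** With W the increment after s j, the mean of F(X(s j) + W) over E equals that of
    F(X(s j) + r W) = - F(r X(s j) + W).  It is therefore half the mean of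
    F(X(s j) + W) - F(r X(s j) + W), whose two arguments differ by at most the value
    of the root at X(s j).  The factor 1/2 is dropped. *)
Lemma reflection_bound a b e E : a != b -> past_event X s j E ->
  (forall x, F (sact (reflD a b e) x) = - F x) ->
  `|\int[P]_(w in E) F (X t w)| <=
  \int[P]_(w in E) Num.min (2 * C) (L * `|rootD a b e (X (s j) w)|).
Proof.
move=> ab pE FN; set r := reflD a b e.
have mE := past_event_measurable hX s0 s_mono pE.
pose G (p : 'rV[R]_n * 'rV[R]_n) := F (p.1 + p.2).
have mG : measurable_fun setT G.
  apply: (measurableT_comp mF); apply: measurable_addrV.
    exact: measurable_fst.
  exact: measurable_snd.
have mrW : measurable_fun setT (fun w => sact r (W w)).
  exact: (measurableT_comp (measurable_sact r)).
have mp1 : measurable_fun setT (fun w => (X (s j) w, W w)).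
  exact/measurable_fun_pairP.
have mp2 : measurable_fun setT (fun w => (X (s j) w, sact r (W w))).
  exact/measurable_fun_pairP.
have E1 := Rintegral_law_eq mp1 mp2 mE (fun A => reflected_law r pE) mG
  (fun p => FC (p.1 + p.2)).
have EF w : F (X t w) = G (X (s j) w, W w) by rewrite /G /W /= addrC subrK.
have EFr w : G (X (s j) w, sact r (W w)) = - F (sact r (X (s j) w) + W w).
  by rewrite /G /= -FN -/r sactD /r sact_reflK.
have mXW : measurable_fun setT (fun w => F (X t w)).
  by under eq_fun do rewrite EF; exact: (measurableT_comp mG mp1).
have mFr : measurable_fun setT (fun w => - F (sact r (X (s j) w) + W w)).
  by under eq_fun do rewrite -EFr; exact: (measurableT_comp mG mp2).
have FrC w : `|- F (sact r (X (s j) w) + W w)| <= C by rewrite normrN.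
have i1 := bounded_integrable P mE mXW (fun w => FC _).
have i2 := bounded_integrable P mE mFr FrC.
have twice : \int[P]_(w in E) F (X t w) + \int[P]_(w in E) F (X t w) =
    \int[P]_(w in E) (F (X t w) + - F (sact r (X (s j) w) + W w)).
  rewrite RintegralD//; congr (_ + _).
  under eq_Rintegral do rewrite EF; rewrite E1.
  by under eq_Rintegral do rewrite EFr.
set I := \int[P]_(w in E) F (X t w) in twice *.
apply: (@le_trans _ _ `|I + I|).
  by rewrite -mulr2n normrMn mulr2n lerDl.
have mroot : measurable_fun setT (fun w => `|rootD a b e (X (s j) w)|).
  apply: (measurableT_comp (@normr_measurable R setT)).
  exact: (measurableT_comp (measurable_rootD a b e) mX).
have C0 : 0 <= C by exact: le_trans (normr_ge0 _) (FC 0).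
rewrite twice; set h := fun w => F (X t w) + - F (sact r (X (s j) w) + W w).
have hC w : `|h w| <= 2 * C.
  by rewrite mulr2n mulrDl mul1r (le_trans (ler_normD _ _))// lerD.
have mh : measurable_fun setT h by exact: measurable_funD.
have L0 w : 0 <= L * `|rootD a b e (X (s j) w)|.
  apply: le_trans (FL (x := X (s j) w) (y := sact r (X (s j) w)) _ _) => //.
  exact: dist_reflD.
apply: le_trans (le_normr_Rintegral mE (bounded_integrable P mE mh hC)) _.
apply: le_Rintegral => //.
- apply: (@bounded_integrable _ _ _ P _ (2 * C)) => //.
    exact: (measurableT_comp (@normr_measurable R setT)).
  by move=> w; rewrite normr_id.
- apply: (@bounded_integrable _ _ _ P _ (2 * C)) => //.
    by apply: measurable_minr => //; exact: measurable_funM.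
  move=> w; rewrite ger0_norm ?ge_min ?lexx//.
  by rewrite le_min L0 mulr_ge0.
- move=> w _; rewrite le_min hC /=.
  rewrite /h {1}(_ : X t w = X (s j) w + W w); last by rewrite /W addrC subrK.
  apply: FL => // i; rewrite [X in `|X|](_ : _ = X (s j) w 0 i - sact r (X (s j) w) 0 i).
    exact: dist_reflD.
  by rewrite !mxE opprD addrACA subrr addr0.
Qed.
End reflection.

(** * Killing on a time grid *)

Section grid.
Context {R : realType}.
Implicit Types (f : R -> R) (t : R).

(** Heine's theorem, from the formulation of compactness by near-coverings. *)
Lemma segment_unif_continuous f t : {within `[0, t], continuous f} ->
  forall eps, 0 < eps -> exists2 eta, 0 < eta &
    forall x y, 0 <= x <= t -> 0 <= y <= t -> `|x - y| < eta -> `|f x - f y| < eps.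
Proof.
move=> cf eps eps0.
pose K : set R := `[0, t]%classic.
have KP x : K x <-> 0 <= x <= t by rewrite /K /= in_itv.
pose Q (k : nat) (x : R) := forall y, K y ->
  `|x - y| < k.+1%:R^-1 -> `|f x - f y| < eps.
have [k _ HQ] : \forall k \near \oo, K `<=` Q k.
  have cK : near_covering_within K.
    by apply/near_covering_withinP/compact_near_coveringP; exact: segment_compact.
  apply: cK => x Kx.
  have := (subspace_continuousP _ _).1 cf x Kx.
  move=> /cvgrPdist_lt /(_ (eps / 2)) /(_ _) [|e /= e0 He]; first by rewrite divr_gt0.
  (* a point x' within e/2 of x and a point y within 1/(k+1) < e/2 of x' are
     both within e of x *)
  have [N HN] : exists N : nat, N.+1%:R^-1 < e / 2.
    exists (Num.truncn (e / 2)^-1); rewrite invf_plt ?posrE ?divr_gt0//.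
    by rewrite truncnS_gt.
  exists (ball x (e / 2), [set k | (N <= k)%N]); rewrite /=.
    split; first by apply: nbhsx_ballx; rewrite divr_gt0.
    by exists N.
  move=> [x' k] /= [xx' Nk] Kx' y Ky x'y.
  have k1 : k.+1%:R^-1 <= N.+1%:R^-1 :> R by rewrite lef_pV2 ?posrE// ler_nat ltnS.
  have e2 : `|x - x'| < e / 2 by exact: xx'.
  have h1 : `|f x - f x'| < eps / 2.
    by apply: He => //=; rewrite /ball /=; lra.
  have h2 : `|f x - f y| < eps / 2.
    apply: He => //=; rewrite /ball /=.
    rewrite (le_lt_trans (ler_distD x' x y))// [e]splitr ltrD//.
    by rewrite (lt_trans x'y)// (le_lt_trans k1).
  apply: le_lt_trans (ler_distD (f x) (f x') (f y)) _.
  by rewrite (distrC (f x') (f x)) [eps]splitr ltrD.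
exists k.+1%:R^-1; first by rewrite invr_gt0.
by move=> x y /KP Kx /KP Ky xy; exact: (HQ k (leqnn k) x Kx y Ky xy).
Qed.

Definition grid t (N i : nat) : R := t * i%:R / N%:R.

Lemma grid0 t N : grid t N 0 = 0. Proof. by rewrite /grid mulr0 mul0r. Qed.

Lemma grid_mono t N i : 0 <= t -> grid t N i <= grid t N i.+1.
Proof. by move=> t0; rewrite /grid ler_wpM2r// ler_wpM2l// ler_nat. Qed.

Lemma grid_ge0 t N i : 0 <= t -> 0 <= grid t N i.
Proof. by move=> t0; rewrite /grid !mulr_ge0. Qed.

Lemma grid_lt t N i : 0 < t -> (i < N)%N -> grid t N i < t.
Proof.
move=> t0 iN; have N0 : 0 < N%:R :> R by rewrite ltr0n (leq_trans _ iN).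
by rewrite /grid ltr_pdivrMr// ltr_pM2l// ltr_nat.
Qed.

Lemma grid_le t N i : 0 <= t -> (0 < N)%N -> (i <= N)%N -> grid t N i <= t.
Proof.
move=> t0 N0 iN; have N0' : 0 < N%:R :> R by rewrite ltr0n.
by rewrite /grid ler_pdivrMr// ler_wpM2l// ler_nat.
Qed.

Lemma grid_step t N i : grid t N i.+1 - grid t N i = t / N%:R.
Proof. by rewrite /grid -mulrBl -mulrBr -natrB ?subSnn ?leqnSn// mulr1. Qed.

Lemma grid_double t k i : grid t (2 ^ k.+1) (2 * i) = grid t (2 ^ k) i.
Proof.
rewrite /grid expnS !natrM; have : (2 ^ k)%:R != 0 :> R by rewrite pnatr_eq0 expn_eq0.
by move=> k0; field.
Qed.

Lemma grid_dense t N x : 0 < t -> (0 < N)%N -> 0 <= x <= t ->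
  exists2 i, (i < N)%N & `|x - grid t N i| <= t / N%:R.
Proof.
move=> t0 N0 /andP[x0 xt]; have N0' : 0 < N%:R :> R by rewrite ltr0n.
move: xt; rewrite le_eqVlt => /predU1P[->|xt].
  exists N.-1; first by rewrite prednK.
  rewrite -[X in `|X - _|](_ : grid t N N.-1.+1 = t).
    by rewrite grid_step ger0_norm// divr_ge0// ltW.
  by rewrite prednK// /grid mulfK// gt_eqF.
pose i := Num.truncn (x / t * N%:R).
have xtN : 0 <= x / t * N%:R by rewrite !mulr_ge0// invr_ge0 ltW.
have /andP[i1 i2] := truncn_itv xtN.
have iN : (i < N)%N.
  rewrite -(ltr_nat R); apply: le_lt_trans i1 _.
  by rewrite gtr_pMl// ltr_pdivrMr// mul1r.
exists i => //.
have g1 : grid t N i <= x.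
  by rewrite /grid ler_pdivrMr// mulrC -ler_pdivlMr// mulrAC.
have g2 : x <= grid t N i.+1.
  rewrite /grid ler_pdivlMr// [t * _]mulrC; move: i2.
  by rewrite -/i mulrAC ltr_pdivrMr// => /ltW.
rewrite ger0_norm ?subr_ge0//; have := grid_step t N i; lra.
Qed.

End grid.

Section discrete_killing.
Context {R : realType} {d} {Omega : measurableType d} (P : probability Omega R).
Variables (n : nat) (eta : 'rV[R]_n) (X : R -> Omega -> 'rV[R]_n).
Hypothesis n2 : (2 <= n)%N.
Hypothesis hX : brownian_motion P eta X.
Variable t : R.
Hypothesis t0 : 0 < t.

Local Notation rootT := ('I_n * 'I_n * bool)%type.
(** All roots exceed delta at the grid times before t; the time t itself is left out
    so that the increment from each grid time up to t is nondegenerate. *)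
Definition stays (N : nat) (delta : R) : set Omega :=
  [set w | forall i r, (i < N)%N -> posroot r ->
    delta < rootv r (X (grid t N i) w)].

(** The largest change over one grid step among all the forms x_a - x_b, x_a + x_b. *)
Definition osc (N : nat) (w : Omega) : R :=
  \big[Num.max/0]_(p : 'I_N * rootT)
    `|rootv p.2 (X (grid t N p.1.+1) w) - rootv p.2 (X (grid t N p.1) w)|.

Lemma osc_ge0 N w : 0 <= osc N w.
Proof. by rewrite /osc; elim/big_ind : _ => // x y x0 y0; rewrite le_max x0. Qed.

Lemma measurable_path s : 0 <= s -> measurable_fun setT (X s).
Proof. exact: (bm_measurable hX). Qed.

Lemma measurable_root_path r s : 0 <= s ->
  measurable_fun setT (fun w => rootv r (X s w)).
Proof.
by move=> s0; apply: (measurableT_comp (measurable_rootD _ _ _)); exact: measurable_path.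
Qed.

Lemma measurable_osc N : measurable_fun setT (osc N).
Proof.
rewrite /osc; elim: (index_enum _) => [|p ps IH].
  by under eq_fun do rewrite big_nil; exact: measurable_cst.
under eq_fun do rewrite big_cons; apply: measurable_maxr => //.
apply: (measurableT_comp (@normr_measurable R setT)).
by apply: measurable_funB; apply: measurable_root_path; apply: grid_ge0; exact: ltW.
Qed.

Variables (F : 'rV[R]_n -> R) (C L : R).
Hypotheses (mF : measurable_fun setT F) (FC : forall x, `|F x| <= C)
  (L0 : 0 <= L) (FL : coord_lipschitz L F).
Hypothesis FN : forall a b e x, a != b -> F (sact (reflD a b e) x) = - F x.

Let C0 : 0 <= C. Proof. exact: le_trans (normr_ge0 _) (FC 0). Qed.

Definition killing_error N delta w : R := Num.min (2 * C) (L * (delta + osc N w)).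

Lemma killing_error_bounded N delta w : 0 <= delta ->
  0 <= killing_error N delta w <= 2 * C.
Proof.
move=> d0; rewrite /killing_error ge_min lexx andbT le_min.
by rewrite !mulr_ge0 ?addr_ge0 ?osc_ge0.
Qed.

Lemma measurable_killing_error N delta :
  measurable_fun setT (killing_error N delta).
Proof.
apply: measurable_minr => //; apply: measurable_funM => //.
by apply: measurable_funD => //; exact: measurable_osc.
Qed.

Let r0 : rootT.
Proof. by split; [split|exact: true]; apply: (@Ordinal n 0); lia. Qed.

(** At the first failure, at time j for the root r, the root exceeds delta one step
    earlier and no longer at j; so its value at j is at most delta plus the
    oscillation in absolute value, and [reflection_bound] applies. *)
Lemma discrete_killing N delta : (0 < N)%N -> 0 <= delta ->
  (forall r, posroot r -> delta < rootv r eta) ->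
  `|\int[P]_w F (X t w) - \int[P]_(w in stays N delta) F (X t w)| <=
  \int[P]_w killing_error N delta w.
Proof.
move=> N0 d0 etad.
(* the conditions are numbered by m = j * K + i, for the root number i at the
   grid time number j, in the order in which they are checked *)
pose rs := [seq r <- enum {: rootT} | posroot r].
pose K := size rs.
have K0 : (0 < K)%N.
  have n0 : (0 < n)%N by lia. have n1 : (1 < n)%N by lia.
  have : (Ordinal n0, Ordinal n1, true) \in rs by rewrite mem_filter /posroot /= mem_enum.
  by rewrite /K; case: (rs).
pose c m := [set w | delta < rootv (nth r0 rs (m %% K)) (X (grid t N (m %/ K)) w)].
have rsP m : posroot (nth r0 rs (m %% K)).
  have : nth r0 rs (m %% K) \in rs by rewrite mem_nth// ltn_mod.
  by rewrite mem_filter => /andP[].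
have pc j m : (m %/ K <= j)%N -> past_event X (grid t N) j (c m).
  move=> mj; rewrite (_ : c m = X (grid t N (m %/ K)) @^-1`
    (rootv (nth r0 rs (m %% K)) @^-1` `]delta, +oo[)); last first.
    by apply/seteqP; split=> w; rewrite /c /= in_itv /= andbT.
  apply: (past_event_X hX (grid0 t N) mj).
  by rewrite -[X in measurable X]setTI; apply: measurable_rootD.
have staysE : stays N delta = \bigcap_(m < N * K) c m.
  apply/seteqP; split=> w /= H.
    by move=> m /= mNK; apply: H => //; rewrite ltn_divLR.
  move=> i r iN pr.
  have rrs : r \in rs by rewrite mem_filter pr mem_enum.
  have := H (i * K + index r rs)%N; rewrite /c /=.
  have ir : (index r rs < K)%N by rewrite index_mem.
  rewrite divnMDl// divn_small// addn0 modnMDl modn_small// nth_index//.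
  apply; rewrite (leq_trans (n := (i * K + K)%N)) ?ltn_add2l//.
  by rewrite -mulSnr leq_mul2r iN orbT.
have gm j : forall k, (k < j)%N -> grid t N k <= grid t N k.+1.
  by move=> k _; apply: grid_mono; exact: ltW.
rewrite staysE; apply: (@first_failure _ _ _ P _ _ (2 * C)).
- by apply: (measurableT_comp mF); apply: measurable_path; exact: ltW.
- by move=> w; rewrite (le_trans (FC _))// ler_peMl// ler1n.
- exact: measurable_killing_error.
- by move=> w; exact: killing_error_bounded.
- by move=> m; exact: (past_event_measurable hX (grid0 t N) (gm _) (pc _ m (leqnn _))).
- move=> m mNK; set D := _ `\` _.
  pose j := (m %/ K)%N; have jN : (j < N)%N by rewrite ltn_divLR.
  pose r := nth r0 rs (m %% K).
  have pD : past_event X (grid t N) j D.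
    pose T := g_sigma_algebraType (past_cylinders X (grid t N) j).
    apply: (@measurableD _ T); last exact: pc.
    apply: (@fin_bigcap_measurable _ T); first exact: finite_II.
    by move=> i /= im; apply: pc; apply: leq_div2r; exact: ltnW.
  have mD := past_event_measurable hX (grid0 t N) (gm _) pD.
  have := rsP m; rewrite -/r /posroot => rr.
  have ab : r.1.1 != r.1.2 by rewrite -val_eqE /= ltn_eqF.
  have := reflection_bound hX (grid0 t N) (gm j) (grid_lt t0 jN) mF FC FL
    (e := r.2) ab pD (fun x => FN r.2 x ab).
  move=> /le_trans; apply.
  have mr : measurable_fun setT (fun w => `|rootD r.1.1 r.1.2 r.2 (X (grid t N j) w)|).
    apply: (measurableT_comp (@normr_measurable R setT)).
    by apply: measurable_root_path; apply: grid_ge0; exact: ltW.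
  have mmin : measurable_fun setT (fun w => Num.min (2 * C)
      (L * `|rootD r.1.1 r.1.2 r.2 (X (grid t N j) w)|)).
    by apply: measurable_minr => //; exact: measurable_funM.
  apply: le_Rintegral => //.
  + apply: (bounded_integrable P mD mmin (C := 2 * C)) => w.
    by rewrite ger0_norm ?ge_min ?lexx// le_min !mulr_ge0.
  + apply: (bounded_integrable P mD (measurable_killing_error N delta) (C := 2 * C)) => w.
    by have /andP[k0 k1] := killing_error_bounded N w d0; rewrite ger0_norm.
  move=> w [Dw /negP]; rewrite /= -leNgt -/j -/r -/(rootv r) => fail.
  rewrite /killing_error le_min ge_min lexx /= ge_min.
  apply/orP; right; apply: ler_wpM2l => //.
  (* the starting point satisfies all conditions, so none fails at time 0 *)
  have j0 : (0 < j)%N.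
    rewrite lt0n; apply/negP => /eqP j0; move: fail.
    by rewrite j0 grid0 (bm_start hX) leNgt etad// rsP.
  (* the same root one grid step earlier is the condition number m - K *)
  have Km : (K <= m)%N by move: j0; rewrite /j divn_gt0.
  have : c (m - K)%N w.
    by apply: Dw => /=; rewrite ltn_subrL K0 (leq_trans K0 Km).
  have -> : c (m - K)%N = [set w | delta < rootv r (X (grid t N j.-1) w)].
    rewrite /c; have -> : ((m - K) %% K = m %% K)%N.
      by rewrite -[in RHS](subnK Km) modnDr.
    have -> : ((m - K) %/ K = j.-1)%N.
      by rewrite /j -[in RHS](subnK Km) divnDr ?dvdnn// divnn K0 addn1.
    by [].
  rewrite /= => prev.
  have jN' : (j.-1 < N)%N by rewrite (leq_ltn_trans (leq_pred j)).
  have := le_bigmax 0 (fun p : 'I_N * rootT =>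
    `|rootv p.2 (X (grid t N p.1.+1) w) - rootv p.2 (X (grid t N p.1) w)|)
    (Ordinal jN', r).
  rewrite -/(osc N w) /= prednK// => ho.
  apply: le_trans (lerD (lexx delta) ho).
  set u := rootv r _ in fail *; set v := rootv r _ in prev *.
  have := ler_norm (u - v); have := ler_norm (v - u); rewrite (distrC v u).
  by move=> ? ?; rewrite ler_norml; apply/andP; split; have := normr_ge0 (u - v); lra.
Qed.

End discrete_killing.

(** * Refining the grid *)

Section killing.
Context {R : realType} {d} {Omega : measurableType d} (P : probability Omega R).

Lemma Rintegral_cvg (f_ : nat -> Omega -> R) (f : Omega -> R) (C : R) :
  (forall k, measurable_fun setT (f_ k)) -> (forall k w, `|f_ k w| <= C) ->
  (forall w, f_ k w @[k --> \oo] --> f w) ->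
  \int[P]_w f_ k w @[k --> \oo] --> \int[P]_w f w.
Proof.
move=> mf_ fC cf.
have mf : measurable_fun setT f by apply: (measurable_fun_cvg mf_) => w _; exact: cf.
have iC : P.-integrable setT (EFin \o cst C).
  by apply: (bounded_integrable P measurableT (C := `|C|)).
have [|||||i1 _ i2] := @dominated_convergence _ _ R P setT measurableT
  (fun k => EFin \o f_ k) (EFin \o f) (EFin \o cst C).
- by move=> k; exact/measurable_EFinP.
- exact/measurable_EFinP.
- by apply: aeW => w _; apply: cvg_EFin; [exact: nearW|exact: cf].
- exact: iC.
- by apply: aeW => w k _; rewrite /= lee_fin.
apply: fine_cvg; rewrite fineK; first exact: i2.
exact: (integrable_fin_num measurableT i1).
Qed.

Lemma Rintegral_restrict (f : Omega -> R) H :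
  \int[P]_(w in H) f w = \int[P]_w (f w * \1_H w).
Proof.
rewrite Rintegral_mkcond; apply: eq_Rintegral => w _.
by rewrite patchE indicE; case: ifP; rewrite ?mulr1 ?mulr0.
Qed.

Lemma Rintegral_cvg_set (f : Omega -> R) (C : R) (H_ : nat -> set Omega) H :
  measurable_fun setT f -> (forall w, `|f w| <= C) ->
  (forall k, measurable (H_ k)) ->
  (forall w, H w -> \forall k \near \oo, H_ k w) ->
  (forall w, ~ H w -> \forall k \near \oo, ~ H_ k w) ->
  \int[P]_(w in H_ k) f w @[k --> \oo] --> \int[P]_(w in H) f w.
Proof.
move=> mf fC mH cH cnH; rewrite Rintegral_restrict.
under eq_fun do rewrite Rintegral_restrict.
apply: (@Rintegral_cvg _ _ C) => [k|k w|w].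
- by apply: measurable_funM => //; exact: measurable_indic.
- rewrite normrM -[leRHS]mulr1 ler_pM// indicE.
  by case: (_ \in _); rewrite ?normr1 ?normr0.
- apply: cvg_near_cst; have [Hw|nHw] := pselect (H w).
    by apply: filterS (cH w Hw) => k Hk; rewrite !indicE !mem_set.
  by apply: filterS (cnH w nHw) => k Hk; rewrite !indicE !memNset.
Qed.

Variables (n : nat) (eta : 'rV[R]_n) (X : R -> Omega -> 'rV[R]_n).
Hypothesis n2 : (2 <= n)%N.
Hypothesis hX : brownian_motion P eta X.
Variable t : R.
Hypothesis t0 : 0 < t.
Local Notation rootT := ('I_n * 'I_n * bool)%type.
Local Notation U := (@chamberD R n)°.

Definition survives : set Omega := [set w | forall s, 0 <= s <= t -> U (X s w)].

Lemma continuous_root_path (r : rootT) w :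
  {within `[0, t], continuous (fun s => rootv r (X s w))}.
Proof.
have cX : {within `[0, t], continuous (X ^~ w)}.
  apply: (continuous_subspaceW _ (@bm_continuous _ _ _ _ _ _ _ hX w)) => s /=.
  by rewrite !in_itv /= andbT => /andP[].
apply/subspace_continuousP => s ts.
have := (subspace_continuousP _ _).1 cX s ts.
move=> cs.
have cc (a : 'I_n) := cvg_comp (X^~ w) (fun x : 'rV[R]_n => x 0 a) cs
  (@coord_continuous R 1 n 0 a (X s w)).
apply: cvgB; first exact: cc.
by apply: cvgM; [exact: cvg_cst|exact: cc].
Qed.

Lemma osc_cvg w : osc X t (2 ^ k) w @[k --> \oo] --> 0.
Proof.
apply/cvgrPdist_lt => eps eps0.
have osc_lt k : (forall r i, (i < 2 ^ k)%N ->
    `|rootv r (X (grid t (2 ^ k) i.+1) w) - rootv r (X (grid t (2 ^ k) i) w)| < eps) ->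
    `|0 - osc X t (2 ^ k) w| < eps.
  move=> H; rewrite sub0r normrN ger0_norm ?osc_ge0// /osc.
  elim/big_ind : _ => // [x y xe ye|p _]; first by rewrite gt_max xe.
  exact: H.
have : \forall k \near \oo, forall r : rootT, forall i, (i < 2 ^ k)%N ->
    `|rootv r (X (grid t (2 ^ k) i.+1) w) - rootv r (X (grid t (2 ^ k) i) w)| < eps.
  apply: filter_forall => r.
  have [e e0 He] := segment_unif_continuous (@continuous_root_path r w) eps0.
  have : \forall k \near \oo, t / e < k%:R by exact: nbhs_infty_gtr.
  apply: filterS => k tek i ik.
  have k2 : (0 < 2 ^ k)%N by rewrite expn_gt0.
  have tl := ltW t0.
  apply: He; rewrite ?grid_ge0 ?grid_le//; first exact: ltnW.
  rewrite grid_step ger0_norm ?divr_ge0// ltr_pdivrMr ?ltr0n// mulrC -ltr_pdivrMr//.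
  by rewrite (lt_trans tek)// ltr_nat ltn_expl.
by apply: filterS => k; exact: osc_lt.
Qed.

Definition stays_dyadic (delta : R) : set Omega :=
  \bigcap_k stays X t (2 ^ k) delta.

(** The dyadic grid is dense in [0, t], and the path is continuous. *)
Lemma stays_dyadic_le delta w r s : stays_dyadic delta w -> posroot r ->
  0 <= s <= t -> delta <= rootv r (X s w).
Proof.
move=> Sw pr st; apply/ler_addgt0Pr => eps eps0.
have [e e0 He] := segment_unif_continuous (@continuous_root_path r w) eps0.
have [k _ /(_ k (leqnn k)) /= tek] : \forall k \near \oo, t / e < k%:R.
  exact: nbhs_infty_gtr.
have k2 : (0 < 2 ^ k)%N by rewrite expn_gt0.
have [i ik si] := grid_dense t0 k2 st.
have : `|rootv r (X s w) - rootv r (X (grid t (2 ^ k) i) w)| < eps.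
  apply: He => //; first by rewrite grid_ge0 ?grid_le ?(ltW t0) ?(ltnW ik).
  apply: (le_lt_trans si).
  rewrite ltr_pdivrMr ?ltr0n// mulrC -ltr_pdivrMr//.
  by rewrite (lt_trans tek)// ltr_nat ltn_expl.
have := Sw k I i r ik pr; rewrite ltr_norml => h /andP[h1 _].
move: h h1; set u := rootv _ _; set v := rootv _ _ => h h1; lra.
Qed.

(** On the compact interval each root attains its minimum along the path. *)
Lemma survives_stays w : survives w ->
  \forall m \near \oo, stays_dyadic m.+1%:R^-1 w.
Proof.
move=> Vw.
have : \forall m \near \oo, forall r : rootT, posroot r ->
    forall s, 0 <= s <= t -> m.+1%:R^-1 < rootv r (X s w).
  apply: filter_forall => r.
  have [|_] := boolP (posroot r); last exact: nearW.
  move=> pr; have [c ct Hc] := EVT_min (ltW t0) (@continuous_root_path r w).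
  have rc0 : 0 < rootv r (X c w).
    by apply: ((chamberD_rootP _ n2).1 (Vw c _)).
  have : \forall m \near \oo, (rootv r (X c w))^-1 < m%:R by exact: nbhs_infty_gtr.
  apply: filterS => m cm _ s st.
  apply: lt_le_trans (Hc s _); last by rewrite in_itv.
  by rewrite invf_plt ?posrE// (lt_trans cm)// ltr_nat.
apply: filterS => m Hm k _ i r ik pr.
have k2 : (0 < 2 ^ k)%N by rewrite expn_gt0.
by apply: Hm => //; rewrite grid_ge0 ?grid_le ?(ltW t0) ?(ltnW ik).
Qed.

Lemma stays_survives delta w : 0 < delta -> stays_dyadic delta w -> survives w.
Proof.
move=> d0 Sw s st; apply/(chamberD_rootP _ n2) => r pr.
exact: lt_le_trans d0 (stays_dyadic_le Sw pr st).
Qed.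

Lemma stays_half k delta : stays X t (2 ^ k.+1) delta `<=` stays X t (2 ^ k) delta.
Proof.
move=> w H i r ik pr; rewrite -grid_double; apply: H => //.
by rewrite expnS ltn_pmul2l.
Qed.

Lemma stays_le k k' delta : (k <= k')%N ->
  stays X t (2 ^ k') delta `<=` stays X t (2 ^ k) delta.
Proof.
move=> /subnK <-; elim: (k' - k)%N => // i IH.
exact: subset_trans (@stays_half _ _) IH.
Qed.

Lemma measurable_stays N delta : measurable (stays X t N delta).
Proof.
rewrite (_ : stays _ _ _ _ = \bigcap_(i < N) \bigcap_(r in [set r : rootT | posroot r])
    ((fun w => rootv r (X (grid t N i) w)) @^-1` `]delta, +oo[)); last first.
  apply/seteqP; split=> w H.
    by move=> i iN r pr; rewrite /= in_itv /= andbT; exact: H.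
  by move=> i r iN pr; have := H i iN r pr; rewrite /= in_itv /= andbT.
apply: fin_bigcap_measurable => [|i _]; first exact: finite_II.
apply: fin_bigcap_measurable => [|r _]; first exact: finite_finset.
rewrite -[X in measurable X]setTI.
by apply: (measurable_root_path hX) => //; apply: grid_ge0; exact: ltW.
Qed.

Lemma measurable_stays_dyadic delta : measurable (stays_dyadic delta).
Proof. by apply: bigcapT_measurable => k; exact: measurable_stays. Qed.

(** By [survives_stays] and [stays_survives] the event only depends on the path at
    dyadic times. *)
Lemma measurable_survives : measurable survives.
Proof.
rewrite (_ : survives = \bigcup_m stays_dyadic m.+1%:R^-1).
  by apply: bigcupT_measurable => m; exact: measurable_stays_dyadic.
apply/seteqP; split=> w; last first.
  by move=> [m _]; apply: stays_survives; rewrite invr_gt0.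
by move=> /survives_stays[m _ Hm]; exists m => //; apply: Hm => /=.
Qed.

Variables (F : 'rV[R]_n -> R) (C L : R).
Hypotheses (mF : measurable_fun setT F) (FC : forall x, `|F x| <= C)
  (L0 : 0 <= L) (FL : coord_lipschitz L F).
Hypothesis FN : forall a b e x, a != b -> F (sact (reflD a b e) x) = - F x.
Hypothesis heta : U eta.

Let mFX : measurable_fun setT (fun w => F (X t w)).
Proof. by apply: (measurableT_comp mF); apply: (measurable_path hX); exact: ltW. Qed.

(** Limit of [discrete_killing] along the dyadic grids, whose events decrease; the
    oscillation tends to 0 along each path. *)
Lemma dyadic_killing delta : 0 <= delta ->
  (forall r, posroot r -> delta < rootv r eta) ->
  `|\int[P]_w F (X t w) - \int[P]_(w in stays_dyadic delta) F (X t w)| <= L * delta.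
Proof.
move=> d0 etad.
have c1 : `|\int[P]_w F (X t w) - \int[P]_(w in stays X t (2 ^ k) delta) F (X t w)|
    @[k --> \oo] -->
    `|\int[P]_w F (X t w) - \int[P]_(w in stays_dyadic delta) F (X t w)|.
  apply: cvg_norm; apply: cvgB; first exact: cvg_cst.
  apply: (@Rintegral_cvg_set _ C) => //.
  - by move=> k; exact: measurable_stays.
  - by move=> w Sw; apply: nearW => k; exact: Sw.
  - move=> w /existsNP[k /not_implyP[_ nk]]; exists k => // k' /= kk'.
    by apply: contra_not nk; exact: stays_le.
have c2 : \int[P]_w killing_error X t C L (2 ^ k) delta w @[k --> \oo] -->
    \int[P]_w Num.min (2 * C) (L * (delta + 0)).
  apply: (@Rintegral_cvg _ _ (2 * C)) => [k|k w|w].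
  - exact: (measurable_killing_error hX).
  - have /andP[h0 h1] := killing_error_bounded X t FC L0 (2 ^ k) w d0.
    by rewrite ger0_norm.
  - have co : L * (delta + osc X t (2 ^ k) w) @[k --> \oo] --> L * (delta + 0).
      apply: cvgM; first exact: cvg_cst.
      by apply: cvgD; [exact: cvg_cst|exact: osc_cvg].
    rewrite /killing_error minr_absE; under eq_fun do rewrite minr_absE.
    apply: cvgM; last exact: cvg_cst.
    apply: cvgB; first by apply: cvgD; [exact: cvg_cst|].
    by apply: cvg_norm; apply: cvgB; [exact: cvg_cst|].
apply: le_trans (ler_cvg_to c1 c2 _) _.
  apply: nearW => k; apply: (discrete_killing n2 hX) => //.
  by rewrite expn_gt0.
rewrite Rintegral_cst// addr0 (_ : fine _ = 1).
  by rewrite mulr1 ge_min lexx orbT.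
by rewrite /= probability_setT.
Qed.

(** Let delta tend to 0 through 1/(m+1); the margin at the starting point is positive,
    so that [dyadic_killing] applies for large m. *)
Lemma killed_mean : \int[P]_w F (X t w) = \int[P]_(w in survives) F (X t w).
Proof.
apply/eqP; rewrite -subr_eq0 -normr_le0.
have c1 : `|\int[P]_w F (X t w) - \int[P]_(w in stays_dyadic m.+1%:R^-1) F (X t w)|
    @[m --> \oo] --> `|\int[P]_w F (X t w) - \int[P]_(w in survives) F (X t w)|.
  apply: cvg_norm; apply: cvgB; first exact: cvg_cst.
  apply: (@Rintegral_cvg_set _ C) => //.
  - by move=> m; exact: measurable_stays_dyadic.
  - by move=> w; exact: survives_stays.
  - move=> w nV; apply: nearW => m; apply: contra_not nV.
    by apply: stays_survives; rewrite invr_gt0.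
have c2 : L * m.+1%:R^-1 @[m --> \oo] --> L * 0.
  by apply: cvgM; [exact: cvg_cst|exact: cvg_harmonic].
rewrite -(mulr0 L); apply: (ler_cvg_to c1 c2).
have : \forall m \near \oo, forall r : rootT, posroot r ->
    m.+1%:R^-1 < rootv r eta.
  apply: filter_forall => r.
  have [|_] := boolP (posroot r); last exact: nearW.
  move=> pr; have r0 := (chamberD_rootP _ n2).1 heta r pr.
  have : \forall m \near \oo, (rootv r eta)^-1 < m%:R by exact: nbhs_infty_gtr.
  apply: filterS => m cm _.
  by rewrite invf_plt ?posrE// (lt_trans cm)// ltr_nat.
by apply: filterS => m Hm; apply: dyadic_killing => //; rewrite invr_ge0.
Qed.

End killing.

(** * The law of the killed motion *)

Section marginal.
Context {R : realType} {d} {Omega : measurableType d} (P : probability Omega R).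
Variables (n : nat) (eta : 'rV[R]_n) (X : R -> Omega -> 'rV[R]_n).
Hypothesis hX : brownian_motion P eta X.
Variable t : R.
Hypothesis t0 : 0 < t.

Let tneq0 : Num.sqrt (t - 0) != 0.
Proof. by rewrite gt_eqF// sqrtr_gt0 subr0. Qed.

Let mX : measurable_fun setT (X t).
Proof. by apply: (bm_measurable hX); exact: ltW. Qed.

Let mW : measurable_fun setT (fun w => X t w - X 0 w).
Proof.
apply: measurable_addrV => //; apply: measurable_opprV.
exact: (bm_measurable hX).
Qed.

Let XE w : X t w = eta + (X t w - X 0 w).
Proof. by rewrite (bm_start hX) addrC subrK. Qed.

Lemma marginal_law g B : measurable B ->
  P [set w | B (sact g (X t w))] =
  (\int[lebesgue_rV n]_(x in B)
     (gauss_density (Num.sqrt t) (sact g eta) x)%:E)%E.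
Proof.
move=> mB.
have := gauss_law eta tneq0 mW (bm_independent_coordinates hX (lexx 0) t0)
  (bm_gaussian_coordinates hX (lexx 0) t0) g mB.
rewrite subr0 => <-; congr (P _); apply/funext => w.
by rewrite /mkset -XE.
Qed.

(** Almost surely X(t) lies on no wall. *)
Lemma marginal_no_tie g a b e : a != b ->
  P [set w | rootD a b e (sact g (X t w)) = 0] = 0%E.
Proof.
move=> ab.
have <- := gauss_no_tie eta tneq0 mW (bm_independent_coordinates hX (lexx 0) t0)
  (bm_gaussian_coordinates hX (lexx 0) t0) g e ab.
by congr (P _); apply/funext => w; rewrite /mkset -XE.
Qed.

Lemma measurable_marginal g : measurable_fun setT (fun w => sact g (X t w)).
Proof. exact: (measurableT_comp (measurable_sact g)). Qed.

Hypothesis n2 : (2 <= n)%N.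
Local Notation U := (@chamberD R n)°.
Local Notation even_signed := (fun g : 'S_n * {set 'I_n} => ~~ odd #|g.2|).
Hypothesis heta : U eta.

Let mU : measurable U.
Proof. by apply: lipschitz_open_measurable; exact: lipschitz_open_chamberD. Qed.

Lemma measurable_antisym (f : 'rV[R]_n -> R) : measurable_fun setT f ->
  measurable_fun setT (antisym f).
Proof.
move=> mf; rewrite /antisym; under eq_fun do rewrite big_mkcond /=.
apply: measurable_sum => g; case: (~~ odd #|g.2|) => //.
by apply: measurable_funM => //; exact: (measurableT_comp mf (measurable_sact g)).
Qed.

Let survivesX : survives X t `<=` [set w | U (X t w)].
Proof. by move=> w Vw; apply: Vw; rewrite (ltW t0) lexx. Qed.

Lemma Rintegral_antisym (f : 'rV[R]_n -> R) (C : R) : measurable_fun setT f ->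
  (forall x, `|f x| <= C) ->
  \int[P]_w antisym f (X t w) =
  \sum_(g | even_signed g) (-1) ^+ odd_perm g.1 * \int[P]_w f (sact g (X t w)).
Proof.
move=> mf fC; rewrite /antisym.
have mfg g : measurable_fun setT (fun w => f (sact g (X t w))).
  exact: (measurableT_comp mf (measurable_marginal g)).
elim: (index_enum _) => [|g gs IH].
  rewrite big_nil; under eq_Rintegral do rewrite big_nil.
  by rewrite Rintegral_cst// mul0r.
rewrite big_cons; under eq_Rintegral do rewrite big_cons.
case: ifP => // og; rewrite -IH RintegralD//=.
- congr (_ + _); rewrite RintegralZl//.
  by apply: (bounded_integrable P measurableT (mfg g) (C := C)) => w.
- apply: (bounded_integrable P measurableT (C := C)).
    exact: measurable_funM.
  by move=> w; rewrite normrM normrX normrN1 expr1n mul1r.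
- apply: (bounded_integrable P measurableT (C := \sum_(h <- gs | even_signed h) C)).
    under eq_fun do rewrite big_mkcond /=.
    by apply: measurable_sum => h; case: (~~ odd #|h.2|) => //; exact: measurable_funM.
  move=> w; apply: le_trans (ler_norm_sum _ _ _) _; apply: ler_sum => h _.
  by rewrite normrM normrX normrN1 expr1n mul1r.
Qed.

(** On the pi-system of the sets {h > 0}, apply [killed_mean] to the antisymmetrized
    ramps of h and of the chamber, then let the ramps tend to the indicator. *)
Lemma killed_alternating A : measurable A ->
  fine (P (survives X t `&` X t @^-1` A)) =
  \sum_(g | even_signed g) (-1) ^+ odd_perm g.1 *
    fine (P [set w | (A `&` U) (sact g (X t w))]).
Proof.
move=> mA.
have mV : measurable (survives X t) by exact: (measurable_survives n2 hX t0).
have mUg g : measurable [set w | U (sact g (X t w))].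
  by rewrite -[X in measurable X]setTI; exact: (measurable_marginal g).
pose m0 : {measure set 'rV[R]_n -> \bar R} := law_on P mV mX.
pose mu g : {measure set 'rV[R]_n -> \bar R} :=
  law_on P (mUg g) (measurable_marginal g).
have muE g B : mu g B = P [set w | (B `&` U) (sact g (X t w))].
  by rewrite /mu /= /law_on; congr (P _); apply/seteqP; split=> w [].
rewrite -[LHS]/(fine (m0 A)); under eq_bigr do rewrite -muE.
apply: (@signed_measure_unique R _ _ _ even_signed m0 mu
  (fun g => (-1) ^+ odd_perm g.1) (@lipschitz_open R n)).
- exact: lipschitz_openI.
- exact: lipschitz_openT.
- by move=> O; exact: lipschitz_open_measurable.
- by apply: le_lt_trans (ltry 1); apply: probability_le1; rewrite preimage_setT setIT.
- move=> g; apply: le_lt_trans (ltry 1).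
  by apply: probability_le1; rewrite preimage_setT setIT.
- move=> O lO; under eq_bigr do rewrite muE.
  have [h [L [mh L0 hL OE]]] := lipschitz_openI lO (lipschitz_open_chamberD n2).
  have mO := lipschitz_open_measurable lO.
  have mOU : measurable (O `&` U) by exact: measurableI.
  pose f k := ramp h k.
  have f1 k x : `|f k x| <= 1.
    by have /andP[? ?] := ramp_bounded h k x; rewrite ger0_norm.
  have mf k : measurable_fun setT (f k) by exact: measurable_ramp.
  have fU k x : ~ U x -> f k x = 0.
    move=> nU; apply: ramp0 => hx; apply: nU.
    suff : (O `&` U) x by case.
    by rewrite OE.
  have mean k : \int[P]_w antisym (f k) (X t w) =
      \int[P]_(w in survives X t) f k (X t w).
    rewrite (killed_mean n2 hX t0 (measurable_antisym (mf k)) (antisym_bounded (f1 k))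
      _ (lipschitz_antisym (lipschitz_ramp k hL))) //.
    + apply: eq_Rintegral => w; rewrite inE => /survivesX Uw.
      by rewrite (antisym_chamber n2)// => y; exact: fU.
    + by apply: sumr_ge0 => g _; rewrite mulr_ge0.
    + by move=> a b e x ab; exact: antisym_refl.
  have lim_f x : f k x @[k --> \oo] --> (\1_(O `&` U) x : R).
    by rewrite OE; exact: ramp_cvg.
  have c1 : \int[P]_w antisym (f k) (X t w) @[k --> \oo] -->
      \sum_(g | even_signed g) (-1) ^+ odd_perm g.1 *
        fine (P [set w | (O `&` U) (sact g (X t w))]).
    under eq_fun do rewrite (Rintegral_antisym (mf _) (f1 _)).
    apply: cvg_bigsum => g _; apply: cvgMr.
    rewrite (_ : fine _ = \int[P]_w \1_(O `&` U) (sact g (X t w))).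
      apply: (@Rintegral_cvg _ _ _ _ _ _ 1) => // k.
      exact: (measurableT_comp (mf k) (measurable_marginal g)).
    rewrite /Rintegral -[in LHS](setIT [set w | _]) -integral_indic//.
    by rewrite -[X in measurable X]setTI; exact: (measurable_marginal g).
  have c2 : \int[P]_(w in survives X t) f k (X t w) @[k --> \oo] --> fine (m0 O).
    rewrite (_ : fine _ = \int[P]_w (\1_(O `&` U) (X t w) * \1_(survives X t) w)).
      under eq_fun do rewrite Rintegral_restrict.
      apply: (@Rintegral_cvg _ _ _ _ _ _ 1) => [k|k w|w].
      + apply: measurable_funM; first exact: (measurableT_comp (mf k)).
        exact: measurable_indic.
      + rewrite normrM -[leRHS]mulr1 ler_pM// indicE.
        by case: (_ \in _); rewrite ?normr1 ?normr0.
      + by apply: cvgM; [exact: lim_f|exact: cvg_cst].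
    rewrite /Rintegral /m0 /= /law_on.
    have mVO : measurable (survives X t `&` X t @^-1` O).
      by apply: measurableI => //; rewrite -[X in measurable X]setTI; exact: mX.
    rewrite -[X in P X](setIT (survives X t `&` _)) -integral_indic//.
    congr fine; apply: eq_integral => w _; congr EFin; rewrite !indicE.
    have [Vw|nVw] := pselect (survives X t w); last first.
      by rewrite (memNset nVw) mulr0 memNset// => -[].
    rewrite (mem_set Vw) mulr1; congr (nat_of_bool _)%:R; apply/idP/idP; rewrite !inE.
      by move=> [_ Ow]; split=> //; exact: survivesX.
    by move=> [Ow _]; split.
  rewrite (_ : (fun k => _) = fun k => \int[P]_(w in survives X t) f k (X t w)) in c1.
    by rewrite -(cvg_lim (@Rhausdorff R) c2) (cvg_lim (@Rhausdorff R) c1).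
  by apply/funext => k; exact: mean.
- exact: lipschitz_open_generates.
Qed.

End marginal.

(** * Expansion of determinants and permanents *)

Section expansion.
Context {R : realType} {n : nat}.
Implicit Types (eta lambda : 'rV[R]_n) (g : 'S_n * {set 'I_n}) (t : R).
Local Notation even_signed := (fun g : 'S_n * {set 'I_n} => ~~ odd #|g.2|).

Lemma heat_kernel_normal t m x : 0 < t ->
  heat_kernel t (x - m) = normal_pdf m (Num.sqrt t) x.
Proof.
move=> t0; rewrite normal_pdfE ?gt_eqF ?sqrtr_gt0//=.
rewrite /heat_kernel /normal_peak /normal_fun sqr_sqrtr ?ltW//.
congr ((Num.sqrt _)^-1 * expR (_ / _)).
  by rewrite -mulr_natr; ring.
by rewrite mulr_natl.
Qed.

Lemma gauss_density_heat t eta lambda s (J : {set 'I_n}) : 0 < t ->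
  gauss_density (Num.sqrt t) (sact (s, J) eta) lambda =
  \prod_i (if i \in J then heat_kernel t (lambda 0 i + eta 0 (s i))
           else heat_kernel t (lambda 0 i - eta 0 (s i))).
Proof.
move=> t0; apply: eq_bigr => i _; rewrite -heat_kernel_normal// sactE /=.
by case: (i \in J); rewrite ?expr1 ?expr0 ?mulN1r ?mul1r ?opprK.
Qed.

(** For a set J of sign changes the product for the minus kernel carries the factor
    (-1)^|J| and the product for the plus kernel the factor 1; half the sum is 1 or 0
    according to the parity of J.  The coefficient c is the sign of the permutation
    for determinants, and 1 for permanents. *)
Lemma half_sum_expansion (c : 'S_n -> R) t eta lambda : 0 < t ->
  2^-1 * (\sum_(s : 'S_n) c s * \prod_i kernel_minus t eta lambda i (s i) +
          \sum_(s : 'S_n) c s * \prod_i kernel_plus t eta lambda i (s i)) =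
  \sum_(g | even_signed g)
    c g.1 * gauss_density (Num.sqrt t) (sact g eta) lambda.
Proof.
move=> t0; rewrite -big_split /= mulr_sumr.
rewrite (eq_bigr (fun s => \sum_(J : {set 'I_n} | ~~ odd #|J|)
    c s * gauss_density (Num.sqrt t) (sact (s, J) eta) lambda)) => [|s _].
  by rewrite pair_big_dep /=; apply: eq_big => -[].
rewrite -mulrDr mulrCA -mulr_sumr; congr (_ * _).
pose a i := heat_kernel t (lambda 0 i - eta 0 (s i)).
pose b i := heat_kernel t (lambda 0 i + eta 0 (s i)).
have -> : \prod_i kernel_minus t eta lambda i (s i) =
    \sum_(J : {set 'I_n}) (-1) ^+ odd #|J| * \prod_i (if i \in J then b i else a i).
  rewrite (eq_bigr (fun i => - b i + a i)) => [|i _]; last by rewrite mxE addrC.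
  rewrite bigA_distr; apply: eq_bigr => J _.
  rewrite odd_cards (big_morph (fun b : bool => (-1) ^+ b : R) (@signr_addb R) (erefl _)).
  rewrite -big_split; apply: eq_bigr => i _.
  by case: (i \in J) => /=; rewrite ?expr1 ?mulN1r ?expr0 ?mul1r.
have -> : \prod_i kernel_plus t eta lambda i (s i) =
    \sum_(J : {set 'I_n}) \prod_i (if i \in J then b i else a i).
  rewrite (eq_bigr (fun i => b i + a i)) => [|i _]; last by rewrite mxE addrC.
  by rewrite bigA_distr.
rewrite -big_split mulr_sumr [RHS]big_mkcond; apply: eq_bigr => J _ /=.
rewrite gauss_density_heat// -/(a _) -/(b _).
move: (\prod_i _) => p; case: (odd _) => /=; rewrite ?expr1 ?expr0; first by ring.
by field.
Qed.

Lemma continuous_gauss_density s eta : s != 0 -> continuous (gauss_density s eta).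
Proof.
move=> s0 x; apply: (@cvg_bigprod R _ (nbhs x) (nbhs_filter x)) => i _.
apply: (@cvg_comp _ _ R (fun y : 'rV[R]_n => y 0 i) (normal_pdf (eta 0 i) s)).
  exact: coord_continuous.
exact: continuous_normal_pdf.
Qed.

End expansion.

(** * Densities *)

Section mixtures.
Context {R : realType} {d} {Omega : measurableType d} (P : probability Omega R).
Variables (n : nat) (eta : 'rV[R]_n) (X : R -> Omega -> 'rV[R]_n).
Hypothesis n2 : (2 <= n)%N.
Hypothesis hX : brownian_motion P eta X.
Variable t : R.
Hypothesis t0 : 0 < t.
Local Notation U := (@chamberD R n)°.
Local Notation G := ('S_n * {set 'I_n})%type.
Local Notation even_signed := (fun g : G => ~~ odd #|g.2|).
Implicit Types (c : G -> R) (B : set 'rV[R]_n).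

(** With c g = sgn(g) this is the density of the killed motion, with c = 1 that of the
    reflected one. *)
Definition mixture c (x : 'rV[R]_n) : R :=
  \sum_(g | even_signed g) c g * gauss_density (Num.sqrt t) (sact g eta) x.

Lemma measurable_mixture c : measurable_fun setT (mixture c).
Proof.
rewrite /mixture; under eq_fun do rewrite big_mkcond /=.
apply: measurable_sum => g; case: (~~ odd #|g.2|) => //.
by apply: measurable_funM => //; exact: measurable_gauss_density.
Qed.

Lemma continuous_mixture c : continuous (mixture c).
Proof.
move=> x; apply: (@cvg_bigsum R _ (nbhs x) (nbhs_filter x)) => g _.
apply: cvgMr; apply: continuous_gauss_density.
by rewrite gt_eqF// sqrtr_gt0.
Qed.

Let integrable_gauss g B : measurable B -> (lebesgue_rV n).-integrable B
  (fun x => (gauss_density (Num.sqrt t) (sact g eta) x)%:E).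
Proof.
move=> mB; apply/integrableP; split.
  by apply: measurable_funTS; apply/measurable_EFinP; exact: measurable_gauss_density.
under eq_integral do rewrite gee0_abs ?lee_fin ?gauss_density_ge0//.
rewrite -(marginal_law hX t0 g mB).
apply: le_lt_trans (ltry 1); apply: probability_le1.
rewrite -[X in measurable X]setTI.
by apply: (measurable_marginal hX t0 g).
Qed.

Lemma integrable_mixture c B : measurable B ->
  (lebesgue_rV n).-integrable B (EFin \o mixture c).
Proof.
move=> mB; rewrite (_ : EFin \o _ = fun x => (\sum_(g | even_signed g)
    (c g)%:E * (gauss_density (Num.sqrt t) (sact g eta) x)%:E)%E).
  by apply: integrable_sum => // g _; apply: integrableZl => //; exact: integrable_gauss.
by apply/funext => x; rewrite /= /mixture -sumEFin.
Qed.

Lemma integral_mixture c B : measurable B ->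
  (\int[lebesgue_rV n]_(x in B) (mixture c x)%:E =
   (\sum_(g | even_signed g)
      c g * fine (P [set w | B (sact g (X t w))]))%:E)%E.
Proof.
move=> mB; rewrite -[LHS]/(\int[lebesgue_rV n]_(x in B) (EFin \o mixture c) x)%E.
rewrite (_ : EFin \o _ = fun x => (\sum_(g | even_signed g)
    (c g)%:E * (gauss_density (Num.sqrt t) (sact g eta) x)%:E)%E); last first.
  by apply/funext => x; rewrite /= /mixture -sumEFin.
rewrite integral_sum//; last first.
  move=> g; apply: (integrableZl mB (c g)) => //; exact: integrable_gauss.
rewrite -sumEFin; apply: eq_bigr => g _.
rewrite (marginal_law hX t0 g mB) EFinM fineK; last first.
  exact: (integrable_fin_num mB (integrable_gauss g mB)).
by apply: integralZl => //; exact: integrable_gauss.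
Qed.

End mixtures.

Section nonnegative.
Context {R : realType} {n : nat}.

(** If f were negative at x, it would be less than f x / 2 on a box around x contained
    in U, and its integral over that box would be negative. *)
Lemma continuous_density_ge0 (U : set 'rV[R]_n) (f : 'rV[R]_n -> R) :
  open U -> (forall x, U x -> {for x, continuous f}) ->
  (forall B, measurable B -> (lebesgue_rV n).-integrable B (EFin \o f)) ->
  (forall B, measurable B -> (0 <= \int[lebesgue_rV n]_(x in B `&` U) (f x)%:E)%E) ->
  forall x, U x -> 0 <= f x.
Proof.
move=> oU cf intf int0 x Ux; rewrite leNgt; apply/negP => fx.
have fx2 : f x < f x / 2 by lra.
have nU : nbhs x (U `&` [set y | f y < f x / 2]).
  apply: (@filterI _ _ (nbhs_filter x)); first exact: open_nbhs_nbhs.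
  exact: (@cvgr_lt _ _ (nbhs x) (nbhs_filter x) _ _ (cf x Ux) _ fx2).
have [e /= e0 He] := (nbhs_ballP _ _).1 nU.
pose A (i : 'I_n) : set R := ball (x 0 i) e.
have mA i : measurable (A i) by rewrite /A ball_itv; exact: measurable_itv.
pose B : set 'rV[R]_n := [set y | forall i, A i (y 0 i)].
have mB : measurable B by exact: measurable_box.
have BU : B `<=` U `&` [set y | f y < f x / 2].
  move=> y By; apply: He; split => // i j; rewrite ord1; exact: By.
have vB : lebesgue_rV n B = ((e *+ 2) ^+ n)%:E.
  rewrite /B lebesgue_rV_box// (eq_bigr (fun=> (e *+ 2)%:E)) => [|i _].
    by rewrite prodEFin prodr_const card_ord.
  by rewrite /A lebesgue_measure_ball// ltW.
have := int0 B mB; rewrite setIidl; last by move=> y /BU[].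
apply/negP; rewrite -ltNge.
apply: (@le_lt_trans _ _ (\int[lebesgue_rV n]_(y in B) (f x / 2)%:E)%E).
  apply: le_integral => //; [exact: intf| |].
    apply/integrableP; split; first exact: measurable_cst.
    by rewrite integral_cst//= vB -EFinM ltry.
  by move=> y; rewrite inE => /BU[_ /= /ltW]; rewrite lee_fin.
rewrite integral_cst//= vB -EFinM lte_fin pmulr_llt0; last by rewrite exprn_gt0// mulrn_wgt0.
lra.
Qed.

End nonnegative.

(** * The law of the reflected motion *)

Section folding.
Context {R : realType} {d} {Omega : measurableType d} (P : probability Omega R).
Variables (n : nat) (eta : 'rV[R]_n) (X : R -> Omega -> 'rV[R]_n).
Hypothesis n2 : (2 <= n)%N.
Hypothesis hX : brownian_motion P eta X.
Variable t : R.
Hypothesis t0 : 0 < t.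
Local Notation U := (@chamberD R n)°.
Local Notation G := ('S_n * {set 'I_n})%type.
Local Notation even_signed := (fun g : G => ~~ odd #|g.2|).

Let mXt (B : set 'rV[R]_n) g : measurable B ->
  measurable [set w | B (sact g (X t w))].
Proof.
by move=> mB; rewrite -[X in measurable X]setTI; apply: (measurable_marginal hX t0 g).
Qed.

Lemma measure_disjoint_sum (T : G -> set Omega) (gs : seq G) : uniq gs ->
  (forall g, measurable (T g)) ->
  (forall g h w, even_signed g -> even_signed h -> T g w -> T h w -> g = h) ->
  P (\bigcup_(g in [set g | g \in gs /\ even_signed g]) T g) =
  (\sum_(g <- gs | even_signed g) P (T g))%E.
Proof.
move=> + mT disj; elim: gs => [_|g gs IH /= /andP[ggs ugs]].
  by rewrite big_nil (_ : \bigcup_(_ in _) _ = set0) ?measure0// bigcup0// => g [].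
have mU : measurable (\bigcup_(h in [set h | h \in gs /\ even_signed h]) T h).
  by apply: fin_bigcup_measurable => // ; exact: finite_finset.
rewrite big_cons; case: ifPn => [og|nog].
  rewrite -IH// -measureU//; last first.
    apply/seteqP; split=> // w [Tg [h [hgs oh] Th]].
    by move: ggs; rewrite (disj _ _ _ og oh Tg Th) hgs.
  congr (P _); apply/seteqP; split=> w.
    move=> [h /= []]; rewrite in_cons => /predU1P[->|hgs] oh Th; first by left.
    by right; exists h.
  move=> [Tg|[h /= [hgs oh] Th]]; first by exists g => //=; rewrite mem_head.
  by exists h => //=; rewrite in_cons hgs orbT.
rewrite -IH//; congr (P _); apply/seteqP; split=> w [h /= [hgs oh] Th].
  exists h => //=; split=> //; move: hgs; rewrite in_cons => /predU1P[hg|//].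
  by rewrite -hg oh in nog.
by exists h => //=; rewrite in_cons hgs orbT.
Qed.

(** Up to the event that X(t) lies on a wall, the events that g X(t) lies in the
    interior of the chamber are disjoint and cover everything. *)
Lemma fold_law A : measurable A ->
  P [set w | A (foldD (X t w))] =
  (\sum_(g | even_signed g) P [set w | (A `&` U) (sact g (X t w))])%E.
Proof.
move=> mA; pose T g := [set w | (A `&` U) (sact g (X t w))].
have mC : measurable (@chamberD R n) by exact: measurable_chamberD.
have mU : measurable U.
  by apply: lipschitz_open_measurable; exact: lipschitz_open_chamberD.
have mT g : measurable (T g) by apply: mXt; exact: measurableI.
have disj g h w : even_signed g -> even_signed h -> T g w -> T h w -> g = h.
  move=> og oh [_ Ug] [_ Uh]; apply: (chamberD_free n2 og oh Ug).
  exact: interior_subset Uh.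
rewrite -(measure_disjoint_sum (index_enum_uniq _) mT disj).
set S := mkset _; set V := \bigcup_(_ in _) T _.
have SE : S = \bigcup_(g in [set g : G | even_signed g])
    [set w | (A `&` chamberD) (sact g (X t w))].
  apply/seteqP; split=> w.
    by move=> /(foldDP n2)[g og H]; exists g.
  by move=> [g og H]; apply/(foldDP n2); exists g.
have mS : measurable S.
  rewrite SE; apply: fin_bigcup_measurable; first exact: finite_finset.
  by move=> g _; apply: mXt; exact: measurableI.
have mV : measurable V.
  by apply: fin_bigcup_measurable => //; exact: finite_finset.
have VS : V `<=` S.
  move=> w [g [_ og] [Ag Ug]]; rewrite SE; exists g => //; split => //.
  exact: interior_subset Ug.
(* a point of the closed chamber outside its interior lies on a wall *)
have nul : P.-negligible (S `\` V).
  pose N (p : G * ('I_n * 'I_n * bool)) : set Omega :=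
    [set w | posroot p.2 /\ rootv p.2 (sact p.1 (X t w)) = 0].
  have : P.-negligible (\big[setU/set0]_p N p).
    elim/big_ind : _ => [|A1 A2|[g r] _]; [exact: negligible_set0|exact: negligibleU|].
    have [pr|npr] := boolP (posroot r); last first.
      rewrite (_ : N _ = set0); first exact: negligible_set0.
      by apply/seteqP; split=> // w [/= pr]; rewrite pr in npr.
    have ab : r.1.1 != r.1.2 by rewrite -val_eqE /= ltn_eqF.
    rewrite (_ : N _ = [set w | rootD r.1.1 r.1.2 r.2 (sact g (X t w)) = 0]).
      apply/negligibleP; last exact: (marginal_no_tie hX t0 g r.2 ab).
      apply: (mXt (B := [set x | rootD r.1.1 r.1.2 r.2 x = 0]) g).
      rewrite -[X in measurable X]setTI.
      exact: (measurable_rootD r.1.1 r.1.2 r.2 measurableT (measurable_set1 (0 : R))).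
    by apply/seteqP; split=> w /= => [[]|].
  apply: negligibleS => w [Sw nVw]; move: Sw; rewrite SE => -[g /= og [Ag Cg]].
  apply: contrapT => nN; apply: nVw; exists g.
    by split=> //; rewrite mem_index_enum.
  split=> //; apply/(chamberD_rootP _ n2) => r pr.
  rewrite lt_neqAle (chamberD_closed_rootP _ n2).1// andbT eq_sym.
  apply/negP => /eqP r0; apply: nN.
  by rewrite (bigD1 (g, r))//=; left.
have mSV : measurable (S `\` V) by exact: measurableD.
rewrite -(setDUK VS) measureU//; last by rewrite setDIK.
by have /negligibleP -> := nul; rewrite ?adde0.
Qed.

End folding.

(** * The two densities *)

Theorem mainTheorem5 (R : realType) (n : nat) (hn : (2 <= n)%N)
  (d : measure_display) (Omega : measurableType d) (P : probability Omega R)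
  (eta : 'rV[R]_n) (heta : (@chamberD R n)° eta) (t : R) (ht : 0 < t)
  (X : R -> Omega -> 'rV[R]_n) (hX : brownian_motion P eta X) :
  density_on (@chamberD R n)° (killed_law P (@chamberD R n)° X t)
    (fun lambda => 2^-1 * (\det (kernel_minus t eta lambda)
                           + \det (kernel_plus t eta lambda)))
  /\
  density_on (@chamberD R n)° (law P (fun s w => foldD (X s w)) t)
    (fun lambda => 2^-1 * (permanent (kernel_minus t eta lambda)
                           + permanent (kernel_plus t eta lambda))).
Proof.
have oU : open (@chamberD R n)° by exact: open_interior.
have mU : measurable (@chamberD R n)°.
  by apply: lipschitz_open_measurable; exact: lipschitz_open_chamberD.
have mX : measurable_fun setT (X t) by apply: (bm_measurable hX); exact: ltW.
have mXt g B : measurable B -> measurable [set w | B (sact g (X t w))].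
  by move=> mB; rewrite -[X in measurable X]setTI; apply: (measurable_marginal hX ht g).
split.
  rewrite (_ : (fun lambda => _) =
    mixture eta t (fun g => (-1) ^+ odd_perm g.1)); last first.
    apply/funext => x; rewrite /mixture.
    by rewrite -(half_sum_expansion (fun s : 'S_n => (-1) ^+ odd_perm s)).
  have EA A : measurable A -> killed_law P (@chamberD R n)° X t A =
      (\int[lebesgue_rV n]_(x in A `&` (@chamberD R n)°)
        (mixture eta t (fun g => (-1) ^+ odd_perm g.1) x)%:E)%E.
    move=> mA; rewrite (integral_mixture hX ht)//; last exact: measurableI.
    rewrite -(killed_alternating hX ht hn heta mA).
    rewrite fineK ?fin_num_measure//; last first.
      apply: measurableI; first exact: (measurable_survives hn hX ht).
      by rewrite -[X in measurable X]setTI; exact: mX.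
    by rewrite /killed_law setIC.
  split => //.
  - by apply: measurable_funTS; exact: measurable_mixture.
  - by move=> x _; exact: continuous_mixture.
  - apply: (continuous_density_ge0 oU) => [x _|B mB|B mB].
    + exact: continuous_mixture.
    + exact: (integrable_mixture hX ht).
    + by rewrite -EA//; exact: measure_ge0.
rewrite (_ : (fun lambda => _) = mixture eta t (fun=> 1)); last first.
  apply/funext => x; rewrite /mixture -(half_sum_expansion (fun=> 1))// /permanent.
  by congr (_ * (_ + _)); apply: eq_bigr => s _; rewrite mul1r.
split.
- by apply: measurable_funTS; exact: measurable_mixture.
- by move=> x _; exact: continuous_mixture.
- by move=> x _; apply: sumr_ge0 => g _; rewrite mul1r gauss_density_ge0.
- move=> A mA; rewrite (integral_mixture hX ht)//; last exact: measurableI.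
  rewrite /law (fold_law hn hX ht mA) -sumEFin; apply: eq_bigr => g _.
  by rewrite mul1r fineK// fin_num_measure//; apply: mXt; exact: measurableI.
Qed.
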